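(* Let $\Gamma$ be any finite connected simplicial graph. Then for the action of the right-angled Artin group $A(\Gamma)$ on the extension graph $\Gamma^e$, every loxodromic element has a rational asymptotic translation length. If in addition the graph $\Gamma$ has girth at least $6$, then the asymptotic translation lengths of the loxodromic elements have a common denominator, i.e. there is a positive integer $D$ such that $D\,\tau(g)\in\mathbb{Z}$ for every loxodromic $g\in A(\Gamma)$.
   Context: For a finite connected simplicial graph $\Gamma$, $A(\Gamma)=\langle v\in V(\Gamma)\mid [u,v]=1 \text{ for all } \{u,v\}\in E(\Gamma)\rangle$ is its right-angled Artin group. For $x,h\in A(\Gamma)$ write $x^h=h^{-1}xh$. The extension graph $\Gamma^e$ is the simplicial graph with vertex set $\{v^g\mid v\in V(\Gamma), g\in A(\Gamma)\}\subset A(\Gamma)$, where two distinct vertices are joined by an edge exactly when they commute in $A(\Gamma)$. It carries the edge metric $d_{\Gamma^e}$ (smallest number of edges in a path between two vertices). $A(\Gamma)$ acts on $\Gamma^e$ on the right by conjugation, $x\mapsto x^g$. The asymptotic translation length of $g\in A(\Gamma)$ is $\tau(g)=\lim_{n\to\infty} d_{\Gamma^e}(x,x^{g^n})/n$, which is independent of the vertex $x$; $g$ is loxodromic if $\tau(g)>0$. The girth of a simplicial graph is the minimum length of an embedded cycle (infinite if there are no cycles). *)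

(* Defs.v *)
From HB Require Import structures.
From mathcomp Require Import all_boot all_order all_algebra.
From mathcomp Require Import all_classical all_reals all_analysis.
Import numFieldNormedType.Exports.

Set Implicit Arguments.
Unset Strict Implicit.
Unset Printing Implicit Defensive.

Local Open Scope classical_set_scope.
Local Open Scope group_scope.

(* A letter [(x, b)] stands for the generator [x] if [b = false] and for its
   inverse if [b = true]. *)
Definition word (X : Type) := seq (X * bool).

Definition letter_inv {X : Type} (a : X * bool) : X * bool := (a.1, ~~ a.2).

Definition word_inv {X : Type} (w : word X) : word X := rev (map letter_inv w).

(* Equality in the group with generators [X] and relators [rels]. *)
Inductive presented_eq (X : Type) (rels : set (word X)) :
  word X -> word X -> Prop :=
| presented_refl w : presented_eq rels w w
| presented_sym w1 w2 : presented_eq rels w1 w2 -> presented_eq rels w2 w1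
| presented_trans w1 w2 w3 : presented_eq rels w1 w2 ->
    presented_eq rels w2 w3 -> presented_eq rels w1 w3
| presented_cancel s a t :
    presented_eq rels (s ++ a :: letter_inv a :: t) (s ++ t)
| presented_relator s r t : rels r -> presented_eq rels (s ++ r ++ t) (s ++ t).

Section PresentedGroup.
Variables (X : choiceType) (rels : set (word X)).
Local Notation eqv := (presented_eq rels).

Definition presented_eqb : rel (word X) := fun w1 w2 => `[< eqv w1 w2 >].

Fact presented_eqb_refl : reflexive presented_eqb.
Proof. by move=> w; apply/asboolP/presented_refl. Qed.

Fact presented_eqb_sym : symmetric presented_eqb.
Proof.
by move=> w1 w2; apply/asboolP/asboolP; apply: presented_sym.
Qed.

Fact presented_eqb_trans : transitive presented_eqb.
Proof.
move=> w2 w1 w3 /asboolP h12 /asboolP h23.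
by apply/asboolP; apply: presented_trans h12 h23.
Qed.

Canonical presented_equiv :=
  EquivRel presented_eqb presented_eqb_refl presented_eqb_sym
           presented_eqb_trans.

Definition presented := {eq_quot presented_equiv}%qT.

HB.instance Definition _ := Choice.on presented.
HB.instance Definition _ := EqQuotient.on presented.

Definition presented_class (w : word X) : presented := (\pi_presented w)%qT.

Lemma presented_classP w1 w2 :
  presented_class w1 = presented_class w2 <-> eqv w1 w2.
Proof.
split=> [/eqmodP/asboolP //|h]; exact/eqmodP/asboolP.
Qed.

Lemma presented_eq_catl s w1 w2 : eqv w1 w2 -> eqv (s ++ w1) (s ++ w2).
Proof.
elim=> [w|? ? _|? ? ? _ + _|u a t|u r t rr].
- exact: presented_refl.
- exact: presented_sym.
- exact: presented_trans.
- by rewrite !catA; apply: presented_cancel.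
- by rewrite !(catA s); apply: presented_relator.
Qed.

Lemma presented_eq_catr s w1 w2 : eqv w1 w2 -> eqv (w1 ++ s) (w2 ++ s).
Proof.
elim=> [w|? ? _|? ? ? _ + _|u a t|u r t rr].
- exact: presented_refl.
- exact: presented_sym.
- exact: presented_trans.
- by rewrite -!catA; apply: presented_cancel.
- by rewrite -!catA; apply: presented_relator.
Qed.

Lemma letter_invK : involutive (@letter_inv X).
Proof. by case=> x b; rewrite /letter_inv /= negbK. Qed.

Lemma word_invK : involutive (@word_inv X).
Proof.
move=> w; rewrite /word_inv map_rev revK -map_comp map_id_in // => a _ /=.
exact: letter_invK.
Qed.

Lemma word_inv_cat w1 w2 :
  word_inv (w1 ++ w2) = word_inv w2 ++ word_inv w1 :> word X.
Proof. by rewrite /word_inv map_cat rev_cat. Qed.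

Lemma presented_eq_mulV w : eqv (w ++ word_inv w) [::].
Proof.
elim: w => [|a w IHw]; first exact: presented_refl.
have -> : (a :: w) ++ word_inv (a :: w)
    = [:: a] ++ (w ++ word_inv w) ++ [:: letter_inv a].
  by rewrite /word_inv /= rev_cons -cats1 -!catA.
apply: presented_trans (presented_cancel _ [::] a [::]).
exact: (presented_eq_catl [:: a] (presented_eq_catr _ IHw)).
Qed.

Lemma presented_eq_Vmul w : eqv (word_inv w ++ w) [::].
Proof. by rewrite -{2}(word_invK w); apply: presented_eq_mulV. Qed.

Lemma presented_eq_inv w1 w2 : eqv w1 w2 -> eqv (word_inv w1) (word_inv w2).
Proof.
move=> h.
apply: (@presented_trans _ _ _ (word_inv w1 ++ w2 ++ word_inv w2)).
  rewrite -{1}(cats0 (word_inv w1)); apply/presented_eq_catl/presented_sym.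
  exact: presented_eq_mulV.
rewrite catA; apply: (@presented_eq_catr (word_inv w2) _ [::]).
apply: presented_trans (presented_eq_Vmul w1).
exact/presented_eq_catl/presented_sym.
Qed.

Definition presented_one : presented := presented_class [::].
Definition presented_mul (g h : presented) : presented :=
  presented_class (repr g ++ repr h)%qT.
Definition presented_inv (g : presented) : presented :=
  presented_class (word_inv (repr g)%qT).

Lemma presented_ind (P : presented -> Prop) :
  (forall w, P (presented_class w)) -> forall g, P g.
Proof. by move=> Pw g; rewrite -[g]reprK; apply: Pw. Qed.

Lemma repr_presented_class w : eqv (repr (presented_class w))%qT w.
Proof. by apply/presented_classP; rewrite [LHS]reprK. Qed.

Lemma presented_classM w1 w2 :
  presented_mul (presented_class w1) (presented_class w2)
  = presented_class (w1 ++ w2).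
Proof.
apply/presented_classP; apply: presented_trans.
  exact/presented_eq_catl/repr_presented_class.
exact/presented_eq_catr/repr_presented_class.
Qed.

Lemma presented_classV w :
  presented_inv (presented_class w) = presented_class (word_inv w).
Proof.
by apply/presented_classP; apply/presented_eq_inv/repr_presented_class.
Qed.

Fact presented_mulA : associative presented_mul.
Proof.
elim/presented_ind=> u; elim/presented_ind=> v; elim/presented_ind=> w.
by rewrite !presented_classM catA.
Qed.

Fact presented_mul1g : left_id presented_one presented_mul.
Proof. by elim/presented_ind=> w; rewrite presented_classM. Qed.

Fact presented_mulg1 : right_id presented_one presented_mul.
Proof. by elim/presented_ind=> w; rewrite presented_classM cats0. Qed.

Fact presented_mulVg : left_inverse presented_one presented_inv presented_mul.
Proof.
elim/presented_ind=> w; rewrite presented_classV presented_classM.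
exact/presented_classP/presented_eq_Vmul.
Qed.

Fact presented_mulgV : right_inverse presented_one presented_inv presented_mul.
Proof.
elim/presented_ind=> w; rewrite presented_classV presented_classM.
exact/presented_classP/presented_eq_mulV.
Qed.

HB.instance Definition _ := isGroup.Build presented
  presented_mulA presented_mul1g presented_mulg1
  presented_mulVg presented_mulgV.

Definition presented_gen (x : X) : presented := presented_class [:: (x, false)].

End PresentedGroup.

Section GraphNotions.

Definition is_walk_length (T : eqType) (e : rel T) (x y : T) (n : nat) : Prop :=
  exists p : seq T, [/\ path e x p, last x p = y & size p = n].

(* Smallest number of edges in a walk from [x] to [y].  The value is [0] when
   [x] and [y] are in different components; this does not happen in the
   extension graph of a connected graph. *)
Definition gdist (T : eqType) (e : rel T) (x y : T) : nat :=
  match pselect (exists n, `[< is_walk_length e x y n >]) with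
  | left ex => ex_minn ex
  | right _ => 0
  end.

(* [cycle e] also holds of the empty sequence and, for symmetric [e], of
   [:: x; y] with [x], [y] adjacent, hence the bound on the size. *)
Definition embedded_cycle (T : eqType) (e : rel T) (c : seq T) : bool :=
  [&& 3 <= size c, cycle e c & uniq c].

Definition girth (R : realType) (T : eqType) (e : rel T) : \bar R :=
  ereal_inf [set ((size c)%:R)%:E%R | c in [set c | embedded_cycle e c]].

End GraphNotions.

Section ExtensionGraph.
(* The edge relation of the defining graph. *)
Variables (V : choiceType) (E : rel V).

Definition commutator_word (u v : V) : word V :=
  [:: (u, true); (v, true); (u, false); (v, false)].

Definition raag_relators : set (word V) :=
  [set w | exists u v, E u v /\ w = commutator_word u v].

Definition raag := presented raag_relators.

HB.instance Definition _ := Group.on raag.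

Definition raag_gen (v : V) : raag := presented_gen raag_relators v.

Definition is_ext_vertex (x : raag) : bool :=
  `[< exists (v : V) (g : raag), x = raag_gen v ^ g >].

Definition ext_vertex := {x : raag | is_ext_vertex x}.

HB.instance Definition _ := Choice.on ext_vertex.
HB.instance Definition _ := SubType.on ext_vertex.

Definition ext_edge : rel ext_vertex :=
  fun x y => (x != y) && `[< commute (val x) (val y) >].

Fact ext_act_subproof (x : ext_vertex) (g : raag) : is_ext_vertex (val x ^ g).
Proof.
apply/asboolP; have /asboolP[v [h ->]] := valP x.
by exists v, (h * g); rewrite conjgM.
Qed.

Definition ext_act (x : ext_vertex) (g : raag) : ext_vertex :=
  Sub (val x ^ g) (ext_act_subproof x g).

Local Open Scope ring_scope.

(* The base point [x] is explicit; the value does not depend on it. *)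
Definition translation_length (R : realType) (x : ext_vertex) (g : raag) : R :=
  limn (fun n : nat =>
    (gdist ext_edge x (ext_act x (g ^+ n)%g))%:R / n%:R : R).

(* Existential rather than universal over base points, so that nothing is
   loxodromic for the empty graph. *)
Definition loxodromic (R : realType) (g : raag) : Prop :=
  exists x : ext_vertex, 0 < translation_length R x g.

End ExtensionGraph.

(* Main.v *)
(* A walk of length N in the extension graph from v0 to the translate of vN by
   an element f is a walk v0, ..., vN in the graph together with a factorization
   f = s0 s1 ... sN, where si belongs to the star subgroup of vi.  If f is given
   by a reduced word, the letters of the word can be distributed among the
   factors compatibly with the heap order.  For a power of a cyclically reduced
   word u whose support is not a join, every position is comparable in the heap
   with all positions a bounded number of periods away.  Hence a geodesic
   passes, at the factor containing the first letter of the i-th period, through the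
   i-th translate of a fixed finite set F, and the translation length is the
   minimal mean weight of a cycle in a weighted digraph on F,
     with denominator at
   most the size of F.
   In girth at least 6, take among the geodesic factorizations one which
   minimizes the sum of the factor indices of all letters.  If the letter at
   position e, labelled v, lies in the factor of w <> v, then every position of
   an earlier factor which is not below e is labelled w: otherwise one could
   either shorten the walk or decrease the sum, by rerouting it through v or by
   moving letters to an earlier factor, or the graph would contain a cycle of
   length at most 5.  So F has one element for each possible w, its size is at
   most the number of vertices of the graph, and the factorial of that number is
   a common denominator. *)

Require Import Defs.
From mathcomp Require Import all_boot all_order all_algebra.
From mathcomp Require Import all_classical all_reals all_analysis.
From mathcomp Require Import zify ring lra.
Import numFieldNormedType.Exports.

Set Implicit Arguments.
Unset Strict Implicit.
Unset Printing Implicit Defensive.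

(** * Reduced words *)

Section Words.
Local Open Scope group_scope.
Variables (V : finType) (E : rel V).
Hypotheses (E_sym : symmetric E) (E_irr : irreflexive E).

Definition cls (w : word V) : raag E := presented_class (raag_relators E) w.

Lemma cls_cat (w1 w2 : word V) : cls (w1 ++ w2) = cls w1 * cls w2.
Proof. by rewrite /cls -presented_classM. Qed.

Lemma cls_nil : cls [::] = 1.
Proof. by []. Qed.

Lemma cls_inv (w : word V) : cls (word_inv w) = (cls w)^-1.
Proof. by rewrite /cls -presented_classV. Qed.

Lemma cls_cons (a : V * bool) (w : word V) : cls (a :: w) = cls [:: a] * cls w.
Proof. exact: (cls_cat [:: a]). Qed.

Lemma cls_letter_inv (a : V * bool) : cls [:: letter_inv a] = (cls [:: a])^-1.
Proof. by rewrite -cls_inv. Qed.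

Lemma cls_surj (g : raag E) : exists w, cls w = g.
Proof. by elim/presented_ind: g => w; exists w. Qed.

Lemma cls_gen (u : V) : cls [:: (u, false)] = raag_gen E u.
Proof. by []. Qed.

Lemma cls_relator (w : word V) : raag_relators E w -> cls w = 1.
Proof.
move=> rw; apply/presented_classP.
by have := presented_relator [::] [::] rw; rewrite cats0.
Qed.

Definition comm (a b : V * bool) := E a.1 b.1.

Lemma comm_sym : symmetric comm. Proof. by move=> a b; apply: E_sym. Qed.

Lemma comm_invl (a b : V * bool) :
  comm (letter_inv a) b = comm a b. Proof. by []. Qed.

Lemma cls_comm (a b : V * bool) : comm a b -> commute (cls [:: a]) (cls [:: b]).
Proof.
have gen x y : E x y -> commute (raag_gen E x) (raag_gen E y).
  move=> Exy; apply/commgP.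
  have -> : [~ raag_gen E x, raag_gen E y] = cls (commutator_word x y).
    rewrite /commutator_word -[_ :: _]/([:: letter_inv (x, false)] ++
      [:: letter_inv (y, false)] ++ [:: (x, false)] ++ [:: (y, false)]).
    by rewrite !cls_cat !cls_letter_inv commgEl conjgE !mulgA.
  by apply/eqP/cls_relator; exists x, y.
have inv (g h : raag E) : commute g h -> commute g^-1 h.
  by move=> c; apply/commute_sym/commuteV/commute_sym.
have clsV z : cls [:: (z, true)] = (raag_gen E z)^-1.
  by rewrite -cls_gen -cls_letter_inv.
case: a b => [x [] ] [y [] ] /gen c; rewrite ?clsV //.
- exact/inv/commuteV.
- exact: inv.
- exact: commuteV.
Qed.

Fixpoint can_cancel (a : V * bool) (W : word V) : bool :=
  if W is b :: W' then (b == letter_inv a) || comm a b && can_cancel a W'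
  else false.

Fixpoint reduced (W : word V) : bool :=
  if W is a :: W' then ~~ can_cancel a W' && reduced W' else true.

Fixpoint del_inv (a : V * bool) (W : word V) : word V :=
  if W is b :: W' then if b == letter_inv a then W' else b :: del_inv a W'
  else [::].

(** Left multiplication by a letter on reduced words. Letting all words act this way, in the style
    of van der Waerden, solves the word problem. *)
Definition mull (a : V * bool) (W : word V) : word V :=
  if can_cancel a W then del_inv a W else a :: W.

Definition mulw (A W : word V) : word V := foldr mull W A.

Lemma can_cancel_cons (a b : V * bool) (W : word V) : can_cancel a (b :: W) =
  (b == letter_inv a) || comm a b && can_cancel a W.
Proof. by []. Qed.

Lemma can_cancel_catP (a : V * bool) (W : word V) : reflect
  (exists W1 W2, [/\ W = W1 ++ letter_inv a :: W2, del_inv a W = W1 ++ W2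
     & all (comm a) W1]) (can_cancel a W).
Proof.
apply: (iffP idP).
  elim: W => //= b W IH; case: eqVneq => [-> _|ne /= /andP[cab /IH]].
    by exists [::], W.
  by move=> [W1 [W2 [-> -> c1]]]; exists (b :: W1), W2; rewrite /= cab.
case=> W1 [W2 [-> _]]; elim: W1 => /= [|b W1 IH]; first by rewrite eqxx.
by move=> /andP[-> /IH ->]; rewrite orbT.
Qed.

Lemma can_cancel_comm (a : V * bool) (W1 W2 : word V) :
  all (comm a) W1 -> can_cancel a (W1 ++ W2) = can_cancel a W2.
Proof.
elim: W1 => //= b W1 IH /andP[cab /IH ->]; rewrite cab /=.
by case: eqP cab => // ->; rewrite /comm /= E_irr.
Qed.

Lemma can_cancel_insert (a b : V * bool) (W1 W2 : word V) :
  comm a b -> can_cancel a (W1 ++ b :: W2) = can_cancel a (W1 ++ W2).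
Proof.
move=> cab; elim: W1 => [|d W1 /= -> //].
by apply: (@can_cancel_comm a [:: b]); rewrite /= cab.
Qed.

Lemma cls_can_cancel (a : V * bool) (W : word V) : can_cancel a W ->
  cls (del_inv a W) = cls (a :: W).
Proof.
move=> /can_cancel_catP[W1 [W2 [-> -> c1]]].
rewrite cls_cons !cls_cat (cls_cons (letter_inv a)) cls_letter_inv.
suff /commute_sym c : commute (cls [:: a]) (cls W1).
  by rewrite !mulgA -c -!mulgA mulVKg.
elim: W1 c1 => [_|b W1 IH /= /andP[/cls_comm cab /IH c]].
  by rewrite cls_nil; apply: commute1.
by rewrite (cls_cons b); apply: commuteM.
Qed.

Lemma cls_mull (a : V * bool) (W : word V) : cls (mull a W) = cls (a :: W).
Proof. by rewrite /mull; case: ifP => // /cls_can_cancel. Qed.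

Lemma cls_mulw (A W : word V) : cls (mulw A W) = cls (A ++ W).
Proof. by elim: A => //= a A IH; rewrite cls_mull cls_cons IH -cls_cons. Qed.

Lemma reduced_del_inv (a : V * bool) (W : word V) : reduced W ->
  can_cancel a W -> reduced (del_inv a W).
Proof.
move=> rW /can_cancel_catP[W1 [W2 [eW -> c1]]]; move: rW; rewrite eW {eW}.
elim: W1 c1 => [_ /andP[] //|b W1 IH /= /andP[cab /IH{}IH] /andP[nb /IH ->]].
by rewrite andbT -(@can_cancel_insert _ (letter_inv a)) // /comm E_sym.
Qed.

Lemma reduced_mull (a : V * bool) (W : word V) : reduced W ->
  reduced (mull a W).
Proof.
rewrite /mull => rW; case: ifP => [/reduced_del_inv->//|/= ->].
by rewrite rW.
Qed.

Lemma reduced_mulw (A W : word V) : reduced W -> reduced (mulw A W).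
Proof. by elim: A => //= a A IH /IH /reduced_mull. Qed.

Lemma mulw_reduced (W : word V) : reduced W -> mulw W [::] = W.
Proof. by elim: W => //= a W IH /andP[/negPf na /IH ->]; rewrite /mull na. Qed.

Lemma cls_reduced (g : raag E) : exists2 W, reduced W & cls W = g.
Proof.
have [A <-] := cls_surj g; exists (mulw A [::]); first exact: reduced_mulw.
by rewrite cls_mulw cats0.
Qed.

(** * Uniqueness of reduced words up to commutation *)

Definition proj (u v : V) (W : word V) : word V :=
  [seq b <- W | (b.1 == u) || (b.1 == v)].

(* Equality in the trace monoid, through projections to pairs of
   noncommuting generators. *)
Definition same_proj (W1 W2 : word V) := forall u v, ~~ E u v ->
  proj u v W1 = proj u v W2.

(** The projections see every letter of [W] that does not commute with [a], so whether [a] cancels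
    depends only on the trace of [W]. *)
Lemma can_cancelP (a : V * bool) (W : word V) : reflect
  (forall v, ~~ E a.1 v -> ohead (proj a.1 v W) = Some (letter_inv a))
  (can_cancel a W).
Proof.
apply: (iffP idP).
  elim: W => //= b W IH;
    case: eqVneq => [-> _ v _|_ /= /andP[cab /IH{}IH] v nv].
    by rewrite /= eqxx.
  have -> : (b.1 == a.1) = false.
    by apply: contraTF cab => /eqP e; rewrite /comm e E_irr.
  have -> /= : (b.1 == v) = false by apply: contraNF nv => /eqP <-.
  exact: IH.
elim: W => [/(_ a.1)|b W IH h] /=; first by rewrite E_irr => /(_ isT).
case: eqVneq => //= ne; case: (boolP (comm a b)) => /= [cab|ncab].
  apply: IH => v nv; have := h v nv; rewrite /=.
  have -> : (b.1 == a.1) = false.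
    by apply: contraTF cab => /eqP e; rewrite /comm e E_irr.
  by have -> /= : (b.1 == v) = false by apply: contraNF nv => /eqP <-.
have := h b.1 ncab; rewrite /= eqxx orbT /= => -[/eqP].
by rewrite (negPf ne).
Qed.

Lemma same_can_cancel (a : V * bool) (W1 W2 : word V) :
  same_proj W1 W2 -> can_cancel a W1 = can_cancel a W2.
Proof.
by move=> h; apply/can_cancelP/can_cancelP => k v nv; rewrite -(k v nv) h.
Qed.

Lemma proj_comm (a : V * bool) (W : word V) (u v : V) : ~~ E u v ->
  (a.1 == u) || (a.1 == v) ->
  all (comm a) W -> proj u v W = [::].
Proof.
move=> nuv auv; elim: W => //= b W IH /andP[cab /IH ->].
suff -> : (b.1 == u) || (b.1 == v) = false by [].
apply: contraTF cab; rewrite /comm.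
have nvu : ~~ E v u by rewrite E_sym.
by case/orP: auv => /eqP->; case/orP=> /eqP->; rewrite ?E_irr.
Qed.

Lemma proj_cat (u v : V) (W1 W2 : word V) :
  proj u v (W1 ++ W2) = proj u v W1 ++ proj u v W2.
Proof. exact: filter_cat. Qed.

Lemma proj_cons (u v : V) (b : V * bool) (W : word V) : proj u v (b :: W) =
  if (b.1 == u) || (b.1 == v) then b :: proj u v W else proj u v W.
Proof. by []. Qed.

Lemma proj_mull (a : V * bool) (W : word V) (u v : V) : ~~ E u v ->
  proj u v (mull a W) =
  if (a.1 == u) || (a.1 == v) then
    if can_cancel a W then behead (proj u v W) else a :: proj u v W
  else proj u v W.
Proof.
move=> nuv; rewrite /mull; case: ifPn => [|nc]; last by rewrite proj_cons.
move=> /can_cancel_catP[W1 [W2 [-> -> c1]]]; rewrite !proj_cat proj_cons /=.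
case: (boolP ((a.1 == u) || (a.1 == v))) => [auv|_] //.
by rewrite (proj_comm nuv auv c1).
Qed.

Lemma same_mull (a : V * bool) (W1 W2 : word V) : same_proj W1 W2 ->
  same_proj (mull a W1) (mull a W2).
Proof.
by move=> h u v nuv; rewrite !proj_mull // (same_can_cancel _ h) h.
Qed.

Lemma same_mulw (A W1 W2 : word V) : same_proj W1 W2 ->
  same_proj (mulw A W1) (mulw A W2).
Proof. by elim: A => //= a A IH /IH /same_mull. Qed.

Lemma same_trans (W1 W2 W3 : word V) :
  same_proj W1 W2 -> same_proj W2 W3 -> same_proj W1 W3.
Proof. by move=> h k u v nuv; rewrite h // k. Qed.

Lemma mullK (a : V * bool) (W : word V) : reduced W ->
  same_proj (mull a (mull (letter_inv a) W)) W.
Proof.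
move=> rW u v nuv; rewrite proj_mull //.
rewrite [mull _ W]/mull.
case: (boolP (can_cancel (letter_inv a) W)) => [|nc]; last first.
  by rewrite can_cancel_cons eqxx /=; case: (_ || _).
move=> /can_cancel_catP[W1 [W2 []]]; rewrite letter_invK => eW -> c1.
move: rW; rewrite eW => rW.
(* Since [W] is reduced, removing the letter [a] between [W1] and [W2] exposes no inverse of [a], so
   [mull a] puts [a] back in front. *)
have -> : can_cancel a (W1 ++ W2) = false.
  rewrite can_cancel_comm //; elim: W1 c1 rW {eW} => [_ /andP[/negPf]//|].
  by move=> b W1 IH /= /andP[_ c1] /andP[_]; apply: IH.
rewrite !proj_cat proj_cons /=;
  case: (boolP ((a.1 == u) || (a.1 == v))) => [auv|_] //.
by rewrite (proj_comm nuv auv c1).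
Qed.

Lemma can_cancel_mull (a b : V * bool) (W : word V) :
  comm a b -> can_cancel a (mull b W) = can_cancel a W.
Proof.
move=> cab; rewrite /mull; case: ifP => [|_].
  by move=> /can_cancel_catP[W1 [W2 [-> -> _]]]; rewrite can_cancel_insert.
exact: (@can_cancel_insert _ _ [::]).
Qed.

Lemma mullC (a b : V * bool) (W : word V) :
  comm a b -> same_proj (mull a (mull b W)) (mull b (mull a W)).
Proof.
move=> cab u v nuv; have cba : comm b a by rewrite comm_sym.
rewrite !proj_mull // !can_cancel_mull //.
case: (boolP ((a.1 == u) || (a.1 == v))) => // auv.
have := @proj_comm a [:: b] u v nuv auv; rewrite /= cab /= => /(_ isT).
by case: ifP.
Qed.

(** Each relation acts trivially on reduced words up to [same_proj]: free cancellation by [mullK], a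
    commutator after exchanging its two middle letters. *)
Lemma presented_same (A1 A2 : word V) : presented_eq (raag_relators E) A1 A2 ->
  forall W, reduced W -> same_proj (mulw A1 W) (mulw A2 W).
Proof.
elim=> [w W _ //|w1 w2 _ IH W rW u v nuv|w1 w2 w3 _ IH1 _ IH2 W rW|s a t W rW|].
- by rewrite IH.
- exact: same_trans (IH1 W rW) (IH2 W rW).
- rewrite /mulw !foldr_cat; apply: same_mulw => /=.
  by apply: mullK; apply: reduced_mulw.
move=> s r t [x [y [Exy ->]]] W rW; rewrite /mulw !foldr_cat.
apply: same_mulw => /=; set W' := foldr _ _ _.
have rW' : reduced W' by apply: reduced_mulw.
have h : comm (y, true) (x, false) by rewrite /comm /= E_sym.
have k := @mullK (y, true) W' rW'.
apply: same_trans (_ : same_proj (mull (x, true) (mull (x, false) W')) W').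
  apply: same_mull; apply: same_trans (mullC _ h) _; apply: same_mull.
  exact: k.
exact: (@mullK (x, true)).
Qed.

Lemma reduced1 (W : word V) : reduced W -> cls W = 1 -> W = [::].
Proof.
move=> rW; rewrite -cls_nil => /presented_classP/presented_same/(_ [::] isT).
rewrite mulw_reduced //= => h; case: W h {rW} => // a W /(_ a.1 a.1).
by rewrite E_irr /= eqxx /= => /(_ isT).
Qed.

Lemma gen_neq1 (u : V) : raag_gen E u != 1.
Proof. by apply/eqP; rewrite -cls_gen => /(@reduced1 [:: (u, false)] isT). Qed.

Lemma cls_behead (a : V * bool) (A W : word V) :
  cls (a :: A) = cls W -> cls A = cls (mull (letter_inv a) W).
Proof.
by move=> h; rewrite cls_mull cls_cons -h cls_letter_inv (cls_cons a A) mulKg.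
Qed.

Lemma size_reduced (A W : word V) : reduced W -> cls A = cls W ->
  size W <= size A.
Proof.
elim: A W => [|a A IH] W rW eq.
  by rewrite (reduced1 rW) // -eq.
have := IH _ (reduced_mull (letter_inv a) rW) (cls_behead eq).
rewrite /mull; case: ifP => [|_] /=; last by lia.
by move=> /can_cancel_catP[W1 [W2 [-> -> _]]]; rewrite !size_cat /=; lia.
Qed.

(* Letters of [A] carry the number of the factor they come from; cancelling
   letters never reverses noncommuting ones, so the tags are inherited by any
   reduced word of the same element. *)
Lemma reduced_tags (A : seq (V * bool * nat)) (W : word V) :
  pairwise (fun x y => x.2 <= y.2) A -> reduced W ->
  cls (map fst A) = cls W ->
  exists T : seq (V * bool * nat), [/\ map fst T = W, {subset T <= A}
    & pairwise (fun x y => comm x.1 y.1 || (x.2 <= y.2)) T].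
Proof.
elim: A W => [|[a t] A IH] W.
  by move=> _ rW eq; exists [::]; rewrite (reduced1 rW) // -eq.
rewrite pairwise_cons => /andP[/allP tA pA] rW eq.
have [T [eT sT pT]] := IH _ pA (reduced_mull (letter_inv a) rW) (cls_behead eq).
move: eT; rewrite /mull; case: ifPn => [/can_cancel_catP[W1 [W2 []]]|_].
  rewrite letter_invK => -> -> c1 eT.
  have /= [e1 e2] : map fst (take (size W1) T) = W1 /\
                 map fst (drop (size W1) T) = W2.
    by rewrite map_take map_drop eT take_size_cat ?drop_size_cat.
  move: sT pT; rewrite -(cat_take_drop (size W1) T).
  move: (take _ _) (drop _ _) e1 e2 => T1 T2 {}eT e2 sT.
  rewrite pairwise_cat => /and3P[p12 p1 p2].
  (* The tag [t] goes where [a] stood in [W]: the letters of [W1] commute with [a], and the tags in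
     [T2] are at least [t]. *)
  exists (T1 ++ (a, t) :: T2); split.
  - by rewrite map_cat /= eT e2.
  - move=> x; rewrite mem_cat !inE orbCA => /orP[->//|xT].
    by apply/orP; right; apply: sT; rewrite mem_cat.
  rewrite pairwise_cat /= p1 p2 !andbT allrel_consr p12 andbT.
  apply/andP; split.
    apply/allP=> x xT; apply/orP; left; rewrite comm_sym.
    by have /allP/(_ x.1) := c1; rewrite comm_invl; apply; rewrite -eT map_f.
  apply/allP=> x xT; apply/orP; right; apply: (tA x); apply: sT.
  by rewrite mem_cat xT orbT.
case: T sT pT => //= b T sT /andP[_ pT] [_ eT]; exists T; split=> // x xT.
by rewrite inE sT ?orbT // inE xT orbT.
Qed.

(** * Stars, centralizers and retractions *)

Definition star (v : V) : pred V := fun u => (u == v) || E v u.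

Definition star_word (v : V) (w : word V) := all (fun b => star v b.1) w.

Lemma star_word_commute (v : V) (w : word V) :
  star_word v w -> commute (raag_gen E v) (cls w).
Proof.
elim: w => [_|a w IH /= /andP[sa /IH c]]; first by rewrite cls_nil;
  apply: commute1.
rewrite (cls_cons a); apply: commuteM => //.
case/orP: sa => [/eqP av|Eva]; last exact: (@cls_comm (v, false)).
case: a av => u [] /= ->; last exact: commute_refl.
by rewrite -[(v, true)]/(letter_inv (v, false)) cls_letter_inv; apply: commuteV.
Qed.

(** If the first letter [a] of the reduced word were outside the star, [a^-1 v a W] would be reduced
    and longer by two than the word [W v] for the same element. *)
Lemma centralizer_gen (v : V) g :
  commute (raag_gen E v) g -> exists2 w, star_word v w & cls w = g.
Proof.
have [W rW <-] := cls_reduced g => {g}.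
elim: W rW => [_ _|a W IH rW cv]; first by exists [::].
have sa : star v a.1.
  have eA : cls (a :: (W ++ [:: (v, false)])) = cls (mull (v, false) (a :: W)).
    by rewrite cls_mull (cls_cons (v, false)) cls_gen cv -cls_gen -cls_cat.
  move: eA; rewrite /mull; case: ifPn => [/=|ncv].
    by rewrite /comm /= => /orP[/eqP -> _|/andP[h _] _];
      rewrite /star ?eqxx ?h ?orbT.
  have rvW : reduced ((v, false) :: a :: W) by rewrite /= ncv.
  move=> eA; have := cls_behead eA.
  rewrite /mull; case: ifPn => [|nca].
    move=> /=; rewrite letter_invK comm_invl /comm /=.
    case: eqP => [<- _|_ /= /andP[h _]] _; first by rewrite /star eqxx.
    by rewrite /star E_sym h orbT.
  have r2 : reduced (letter_inv a :: (v, false) :: a :: W).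
    by apply/andP; split.
  by move=> /(size_reduced r2); rewrite size_cat /=; lia.
have [w sw ew] : exists2 w, star_word v w & cls w = cls W.
  apply: IH; first by case/andP: rW.
  have ca : commute (raag_gen E v) (cls [:: a]).
    by apply: star_word_commute; rewrite /star_word /= sa.
  rewrite -[cls W](mulKg (cls [:: a])) -cls_cons.
  by apply: commuteM => //; apply: commuteV.
by exists (a :: w); rewrite /= ?sa // cls_cons ew -cls_cons.
Qed.

(** The retraction onto the subgroup generated by [P] is well defined: killing the other generators
    sends a relator to a relator or to a freely trivial word. *)
Lemma cls_filter (P : pred V) (A1 A2 : word V) : cls A1 = cls A2 ->
  cls [seq b <- A1 | P b.1] = cls [seq b <- A2 | P b.1].
Proof.
move=> /presented_classP; elim=> [//|? ? _ ->//|? ? ? _ -> _ ->//|s a t|].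
  rewrite !filter_cat !cls_cat /=; case: (P a.1) => //; congr (_ * _).
  by rewrite cls_cons (cls_cons (letter_inv a)) cls_letter_inv mulVKg.
move=> s r t [x [y [Exy ->]]]; rewrite !filter_cat !cls_cat.
suff -> : cls [seq b <- commutator_word x y | P b.1] = 1 by rewrite mul1g.
rewrite /commutator_word /=; case: (boolP (P x)); case: (boolP (P y)) => // _ _.
- by apply: cls_relator; exists x, y.
- by rewrite -(mulVg (cls [:: (x, false)])) -cls_letter_inv -cls_cat.
- by rewrite -(mulVg (cls [:: (y, false)])) -cls_letter_inv -cls_cat.
Qed.

End Words.

(** * Walks in the extension graph *)

Section ExtensionGraph.
Local Open Scope group_scope.
Variables (V : finType) (E : rel V).
Hypotheses (E_sym : symmetric E) (E_irr : irreflexive E).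
Hypothesis E_conn : forall u v : V, connect E u v.

Local Notation cls := (cls E).
Local Notation star := (star E).
Local Notation star_word := (star_word E).

Fact vtx_subproof (h : raag E) (v : V) : is_ext_vertex (raag_gen E v ^ h^-1).
Proof. by apply/asboolP; exists v, h^-1. Qed.

(* Conjugating by [h^-1] turns the right action on the extension graph into a
   left action on labels [h]. *)
Definition vtx (h : raag E) (v : V) : ext_vertex E :=
  Sub (raag_gen E v ^ h^-1) (vtx_subproof h v).

Lemma ext_vertexP (x : ext_vertex E) : exists h v, x = vtx h v.
Proof.
have /asboolP[v [g xE]] := valP x; exists g^-1, v; apply: val_inj.
by rewrite SubK invgK.
Qed.

Lemma ext_act_vtx (h : raag E) (v : V) (g : raag E) :
  ext_act (vtx h v) g = vtx (g^-1 * h) v.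
Proof. by apply: val_inj; rewrite !SubK invgM invgK conjgM. Qed.

Lemma conj_gen_star (v : V) (s : word V) : star_word v s ->
  raag_gen E v ^ (cls s)^-1 = raag_gen E v.
Proof.
move=> /(star_word_commute) c; apply/conjg_fixP/commgP; exact: commuteV.
Qed.

Lemma vtx_star (h : raag E) (v : V) (s : word V) : star_word v s ->
  vtx (h * cls s) v = vtx h v.
Proof.
by move=> sv; apply: val_inj; rewrite !SubK invgM conjgM conj_gen_star.
Qed.

Lemma vtx_eq (h h' : raag E) (v w : V) : vtx h v = vtx h' w ->
  v = w /\ exists2 s, star_word v s & h' = h * cls s.
Proof.
move=> /(congr1 val); rewrite !SubK => eq.
have {eq} eq : raag_gen E v = raag_gen E w ^ (h'^-1 * h).
  by rewrite conjgM -eq -conjgM mulVg conjg1.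
(* Otherwise the retraction onto the powers of [v] would fix [v] and send the conjugate of [w] to
   1. *)
have vw : v = w.
  apply/eqP; apply: contraT => nvw.
  have [q qE] := cls_surj (h'^-1 * h).
  have : cls [:: (v, false)] = cls (word_inv q ++ (w, false) :: q).
    by rewrite cls_cat (cls_cons _ _ q) cls_inv qE !cls_gen eq.
  move=> /(cls_filter (pred1 v)); rewrite filter_cat /= eqxx eq_sym (negPf nvw).
  rewrite cls_cat.
  have -> : [seq b <- word_inv q | pred1 v b.1] =
            word_inv [seq b <- q | pred1 v b.1].
    rewrite /word_inv filter_rev; congr rev.
    by elim: (q) => //= b r ->; case: ifP.
  by rewrite cls_inv mulVg cls_gen => /eqP;
    rewrite (negPf (gen_neq1 E_sym E_irr v)).
split=> //; move: eq; rewrite -vw => eq.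
have [|s sv sE] := @centralizer_gen _ _ E_sym E_irr v (h^-1 * h').
  apply/commgP/conjg_fixP; rewrite {1}eq -conjgM mulgA -(mulgA _ h) mulgV.
  by rewrite mulg1 mulVg conjg1.
by exists s; rewrite // sE mulVKg.
Qed.

Lemma ext_edge_vtx (h : raag E) (v w : V) : E v w ->
  ext_edge (vtx h v) (vtx h w).
Proof.
move=> Evw; apply/andP; split.
  by apply: contraL Evw => /eqP/vtx_eq[-> _]; rewrite E_irr.
apply/asboolP; rewrite /= /commute -!conjMg.
by rewrite (@cls_comm _ _ (v, false) (w, false) Evw).
Qed.

Lemma commuteJ (g x y : raag E) : commute x y -> commute (x ^ g) (y ^ g).
Proof. by rewrite /commute -!conjMg => ->. Qed.

Lemma ext_edgeP (h : raag E) (v : V) (y : ext_vertex E) :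
  ext_edge (vtx h v) y ->
  exists w s, [/\ E v w, star_word v s & y = vtx (h * cls s) w].
Proof.
have [h' [w ->]] := ext_vertexP y; move=> /andP[nxy /asboolP].
rewrite !SubK.
move=> /(commuteJ h); rewrite -!conjgM mulVg conjg1.
set k := h'^-1 * h => c.
have [s sv sE] := centralizer_gen E_sym E_irr c.
have [q qE] := cls_surj k.
(* A conjugate of [w] in the star subgroup of [v] equals its own retraction, so the conjugator [q]
   may be replaced by its star part [qf]. *)
pose P := star v; pose qf := [seq b <- q | P b.1].
have sqf : star_word v (word_inv qf).
  apply/allP=> b; rewrite mem_rev => /mapP[b' + ->].
  by rewrite mem_filter => /andP[].
have e1 : cls s = cls (word_inv q ++ (w, false) :: q).
  by rewrite cls_cat (cls_cons _ _ q) cls_inv qE cls_gen sE.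
have e2 : cls s = (cls qf)^-1 * cls (if P w then (w, false) :: qf else qf).
  have := cls_filter P e1; rewrite filter_cat cls_cat /=.
  rewrite (all_filterP sv) => ->; rewrite -cls_inv; congr (cls _ * _).
  rewrite /word_inv filter_rev; congr rev.
  by rewrite /qf; elim: (q) => //= b r ->; case: (P b.1).
have wv : P w.
  apply: contraT => nPw; move: e2; rewrite (negPf nPw) mulVg sE => /eqP.
  by rewrite conjg_eq1 (negPf (gen_neq1 E_sym E_irr w)).
have yE : vtx h' w = vtx (h * cls (word_inv qf)) w.
  apply: val_inj; rewrite !SubK; apply: (can_inj (conjgK h)).
  rewrite -!conjgM cls_inv invgM invgK mulgVK -/k -sE e2 wv (cls_cons _ _ qf) cls_gen.
  by rewrite -conjgE.
exists w, (word_inv qf); split=> //.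
case/orP: wv => // /eqP wv; move: nxy; rewrite yE wv vtx_star //.
by rewrite eqxx.
Qed.

(** * Distances in the extension graph *)

Local Notation walkn := (is_walk_length (@ext_edge _ E)).
Local Notation d := (gdist (@ext_edge _ E)).

Lemma walkn0 (x : ext_vertex E) : walkn x x 0. Proof. by exists [::]. Qed.

Lemma walkn_trans (x y z : ext_vertex E) m n : walkn x y m ->
  walkn y z n -> walkn x z (m + n).
Proof.
move=> [p [pp pl ps]] [q [qp ql qs]]; exists (p ++ q).
by rewrite cat_path last_cat size_cat pl pp qp ql ps qs.
Qed.

Lemma walkn1 (x y : ext_vertex E) : ext_edge x y -> walkn x y 1.
Proof. by move=> e; exists [:: y]; rewrite /= e. Qed.

Lemma ext_edge_act (g : raag E) (x y : ext_vertex E) :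
  ext_edge (ext_act x g) (ext_act y g) = ext_edge x y.
Proof.
rewrite /ext_edge -!(inj_eq val_inj) !SubK (inj_eq (@conjg_inj _ g)).
congr andb; apply/asbool_equiv_eq; rewrite /commute -!conjMg.
by split=> [/conjg_inj|->].
Qed.

Lemma walkn_act (g : raag E) (x y : ext_vertex E) n : walkn x y n ->
  walkn (ext_act x g) (ext_act y g) n.
Proof.
move=> [p [pp <- <-]]; exists [seq ext_act z g | z <- p].
rewrite (last_map (@ext_act _ E ^~ g)) size_map; split=> //.
by elim: p x pp => //= z p IH x /andP[e /IH ->]; rewrite ext_edge_act e.
Qed.

Lemma ext_actK (g : raag E) : cancel (@ext_act _ E ^~ g) (@ext_act _ E ^~ g^-1).
Proof. by move=> x; apply: val_inj; rewrite !SubK conjgK. Qed.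

Lemma walkn_vtx (h : raag E) (u v : V) : exists n, walkn (vtx h u) (vtx h v) n.
Proof.
have /connectP[p] := E_conn u v; elim: p u => [|w p IH] u /=.
  by move=> _ ->; exists 0%N; apply: walkn0.
move=> /andP[Euw pp] vE; have [n wn] := IH w pp vE.
by exists (1 + n)%N; apply: walkn_trans wn; apply/walkn1/ext_edge_vtx.
Qed.

(** The copies of the graph at [h] and at [h] times a letter [a] share the vertex labelled [a.1], so
    connectedness passes to the extension graph. *)
Lemma walkn_ex (x y : ext_vertex E) : exists n, walkn x y n.
Proof.
have [h [v ->]] := ext_vertexP x; have [h' [w ->]] := ext_vertexP y.
have [q qE] := cls_surj (h^-1 * h');
  have -> : h' = h * cls q by rewrite qE mulVKg.
elim: q {qE} h v => [|a q IH] h v; first by rewrite cls_nil mulg1;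
  apply: walkn_vtx.
have [n1 w1] := walkn_vtx h v a.1.
have sa : star_word a.1 [:: a] by rewrite /star_word /= /star eqxx.
rewrite -(vtx_star _ sa) in w1.
have [n2 w2] := IH (h * cls [:: a]) a.1.
exists (n1 + n2)%N; rewrite cls_cons mulgA.
exact: walkn_trans w1 w2.
Qed.

Lemma gdist_walk (x y : ext_vertex E) : walkn x y (d x y).
Proof.
rewrite /gdist; case: pselect => [ex|nex].
  by case: ex_minnP => m /asboolP.
by exfalso; apply: nex; have [n wn] := walkn_ex x y; exists n; apply/asboolP.
Qed.

Lemma gdist_le (x y : ext_vertex E) n : walkn x y n -> (d x y <= n)%N.
Proof.
move=> wn; rewrite /gdist; case: pselect => [ex|nex].
  by case: ex_minnP => m _; apply; apply/asboolP.
by exfalso; apply: nex; exists n; apply/asboolP.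
Qed.

Lemma gdist_triangle (x y z : ext_vertex E) : (d x z <= d x y + d y z)%N.
Proof. by apply: gdist_le; apply: walkn_trans; apply: gdist_walk. Qed.

Lemma gdist_act (g : raag E) (x y : ext_vertex E) :
  d (ext_act x g) (ext_act y g) = d x y.
Proof.
apply/eqP; rewrite eqn_leq; apply/andP; split; apply: gdist_le.
  by apply: walkn_act; apply: gdist_walk.
have := walkn_act g^-1 (gdist_walk (ext_act x g) (ext_act y g)).
by rewrite (ext_actK g x) (ext_actK g y).
Qed.

Lemma gdist_vtx k (h h' : raag E) (v w : V) :
  d (vtx (k * h) v) (vtx (k * h') w) = d (vtx h v) (vtx h' w).
Proof. by rewrite -(gdist_act k^-1 (vtx h v)) !ext_act_vtx invgK. Qed.

(** The [i]-th factor fixes the vertex labelled [vs i], so consecutive vertices lie in the common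
    copy of the graph at [H i.+1]. *)
Lemma gdist_chain (vs : nat -> V) (H : nat -> raag E) N :
  (forall i, i < N -> E (vs i) (vs i.+1) /\
     exists2 s, star_word (vs i) s & (H i.+1 = H i * cls s)%g)%N ->
  forall i j, (i <= j <= N)%N ->
    (d (vtx (H i) (vs i)) (vtx (H j) (vs j)) <= j - i)%N.
Proof.
move=> hyp i j /andP[ij jN]; apply: gdist_le.
rewrite -(subnKC ij) in jN *; move: (j - i)%N jN => m {ij j}.
rewrite addKn; elim: m => [|m IH] mN; first by rewrite addn0; apply: walkn0.
rewrite -[m.+1]addn1 addnA; apply: walkn_trans (IH _) (walkn1 _); first by lia.
have [|Evw [s sv HE]] := hyp (i + m)%N; first by lia.
rewrite addn1 HE -(vtx_star (H (i + m)%N) sv); exact: ext_edge_vtx.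
Qed.

(** [A] lists the letters of the star factors along the walk, each tagged with the index of its
    factor. *)
Lemma walkn_chain (h h' : raag E) (v w : V) n : walkn (vtx h v) (vtx h' w) n ->
  exists (vs : nat -> V) (A : seq (V * bool * nat)),
   [/\ vs 0 = v, vs n = w, forall i, i < n -> E (vs i) (vs i.+1),
       pairwise (fun a b => a.2 <= b.2) A /\
         (forall a, a \in A -> a.2 <= n /\ star (vs a.2) a.1.1)
     & cls (map fst A) = (h^-1 * h')%g]%N.
Proof.
move=> [p [pp pl <-]]; elim: p h v pp pl => [|y p IH] h v /=.
  move=> _ /vtx_eq[<- [s sv ->]].
  exists (fun=> v), [seq (b, 0%N) | b <- s]; split=> //; last first.
    by rewrite -map_comp map_id mulKg.
  split; first by elim: (s) => //= b r ->; rewrite andbT;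
    apply/allP=> x /mapP[? _ ->].
  by move=> x /mapP[b bs ->] /=; split=> //; have /allP := sv; apply.
move=> /andP[/ext_edgeP[u [s [Evu sv ->]]] pp] pl.
have [vs [A [v0 vn vE [pA sA] cA]]] := IH _ _ pp pl.
exists (fun i => if i is i'.+1 then vs i' else v).
exists ([seq (b, 0%N) | b <- s] ++ [seq (a.1, a.2.+1) | a <- A]); split=> //.
- by case=> [|i] //=; rewrite ?v0 // => iN; apply: vE.
- split.
    rewrite pairwise_cat; apply/and3P; split; last by rewrite pairwise_map.
      by apply/allrelP=> a b /mapP[? _ ->] /mapP[? _ ->].
    by elim: (s) => //= b r ->; rewrite andbT; apply/allP=> x /mapP[? _ ->].
  move=> x; rewrite mem_cat => /orP[] /mapP[b bs ->] /=.
    by split=> //; have /allP := sv; apply.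
  by have [] := sA b bs.
rewrite map_cat cls_cat -!map_comp map_id.
by rewrite -[map (_ \o _) A]/(map fst A) cA invgM !mulgA mulgV mul1g.
Qed.

End ExtensionGraph.

(** * Rational growth from finitely many crossing points *)

(** The block [B] is a closed loop that can be cut out of the walk [x :: s]. *)
Lemma seq_repeat (T : eqType) (x : T) (s : seq T) : ~~ uniq (x :: s) ->
  exists A B C, [/\ s = A ++ B ++ C, 0 < size B & last x A = last x (A ++ B)].
Proof.
elim: s x => [|y s IH] x //; rewrite [uniq _]/= negb_and negbK.
case/orP=> [|/IH[A [B [C [-> B0 e]]]]]; last by exists (y :: A), B, C.
case/splitPr=> p1 p2; exists [::], (rcons p1 x), p2.
by rewrite cat_rcons size_rcons last_rcons.
Qed.

Lemma min_fraction (s : seq (nat * nat)) : s != [::] ->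
  (forall p, p \in s -> 0 < p.2) ->
  exists2 p, p \in s & forall p', p' \in s -> p.1 * p'.2 <= p'.1 * p.2.
Proof.
elim: s => // p [_ _ _|p1 s IH _ pos].
  by exists p; rewrite ?inE // => p'; rewrite inE => /eqP->.
have [//|p' p's|r rs rmin] := IH; first by apply: pos; rewrite inE p's orbT.
have r0 : 0 < r.2 by apply: pos; rewrite inE rs orbT.
have p0 : 0 < p.2 by apply: pos; rewrite inE eqxx.
case: (leqP (p.1 * r.2) (r.1 * p.2)) => [pr|/ltnW rp]; last first.
  by exists r => [|p']; rewrite inE ?rs ?orbT //; case/orP=> [/eqP->|/rmin].
exists p => [|p']; rewrite inE ?eqxx //; case/orP=> [/eqP->//|p's].
have tr a b c d e f : 0 < f -> a * f <= e * b -> e * d <= c * f -> a * d <= c * b.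
  by move=> f0 h1 h2; nia.
exact: tr r0 pr (rmin _ p's).
Qed.

Section RationalTranslation.
Variables (T : eqType) (d : T -> T -> nat) (act : nat -> T -> T).
Hypothesis d_refl : forall x, d x x = 0.
Hypothesis d_triangle : forall x y z, d x z <= d x y + d y z.
Hypothesis d_act : forall i x y, d (act i x) (act i y) = d x y.
Hypothesis act0 : forall x, act 0 x = x.
Hypothesis actD : forall i j x, act (i + j) x = act i (act j x).

(** The list records points modulo translation: entry number [i] stands for its [i]-th translate,
    hence the shift by one in each step. *)
Definition weight x s := sumn (pairmap (fun a b => d a (act 1 b)) x s).

Lemma weight_cat x s t : weight x (s ++ t) = weight x s + weight (last x s) t.
Proof. by rewrite /weight pairmap_cat sumn_cat. Qed.

Lemma dist_le_weight x s : d x (act (size s) (last x s)) <= weight x s.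
Proof.
elim: s x => [|y s IH] x /=; first by rewrite act0 d_refl.
rewrite /weight /= -/(weight y s) -addn1 addnC actD.
apply: leq_trans (d_triangle _ (act 1 y) _) _.
by rewrite d_act leq_add2l.
Qed.

Variables (a : T) (q : nat).
Hypothesis q_gt0 : 0 < q.
Local Notation m := (d a (act q a)).

Lemma iterate_upper n : d a (act (n * q) a) <= n * m.
Proof.
elim: n => [|n IH]; first by rewrite mul0n act0 d_refl.
rewrite mulSn actD; apply: leq_trans (d_triangle _ (act q a) _) _.
by rewrite d_act mulSn leq_add2l.
Qed.

Lemma orbit_upper x : exists K, forall n, q * d x (act n x) <= m * n + K.
Proof.
(* The remainder of [n] modulo [q] displaces [a] by one of the finitely many amounts in the sum,
   which bounds it uniformly. *)
exists (q * (d x a + d a x) + q * \sum_(r < q) d a (act r a)) => n.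
have e1 := d_triangle x a (act n x).
have e2 := d_triangle a (act n a) (act n x); rewrite d_act in e2.
have e3 : d a (act n a) <= n %/ q * m + d a (act (n %% q) a).
  rewrite {1}(divn_eq n q) actD.
  apply: leq_trans (d_triangle _ (act (n %/ q * q) a) _) _.
  by rewrite d_act leq_add2r iterate_upper.
have e4 : d a (act (n %% q) a) <= \sum_(r < q) d a (act r a).
  by rewrite (bigD1 (Ordinal (ltn_pmod n q_gt0))) //= leq_addr.
have e5 : n %/ q * q <= n by apply: leq_trunc_div.
move: (\sum_(_ < _) _) (d a (act (n %% q) a)) e3 e4 => S r e3 e4; nia.
Qed.

Variable F : seq T.
Hypothesis m_min :
  forall b j, b \in F -> 0 < j <= size F -> m * j <= d b (act j b) * q.

(** While the walk has at least [size F] steps, it closes a loop of at most that length. By [m_min]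
    the loop weighs at least [m / q] per step, and it is cut out. *)
Lemma weight_lower x s : {subset x :: s <= F} ->
  m * size s <= q * weight x s + m * size F.
Proof.
have [n] := ubnP (size s); elim: n s => // n IH s sn sF.
have [sM|Ms] := ltnP (size s) (size F); first by nia.
have : ~~ uniq (x :: take (size F) s).
  apply/negP=> ux; have h := @uniq_leq_size _ _ F ux; have : size F < size F.
    apply: leq_trans (h _); first by rewrite /= size_take_min; lia.
    move=> y; rewrite inE => yt; apply: sF; rewrite inE.
    by case/orP: yt => [->//|/mem_take->]; rewrite orbT.
  by rewrite ltnn.
move=> /seq_repeat[A [B [C [eT B0 eL]]]].
have eS : s = A ++ B ++ C ++ drop (size F) s.
  by rewrite -{1}(cat_take_drop (size F) s) eT -!catA.
move: (C ++ _) eS => D eS.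
have BM : size B <= size F.
  have := congr1 size eT; rewrite size_take_min !size_cat; lia.
have IHA : m * size (A ++ D) <= q * weight x (A ++ D) + m * size F.
  apply: IH; first by move: sn; rewrite eS !size_cat; lia.
  move=> y yAD; apply: sF; move: yAD; rewrite eS !(inE, mem_cat).
  by case/or3P=> ->; rewrite ?orbT.
have lF : last x A \in F.
  apply: sF; have := mem_last x A; rewrite eS !(inE, mem_cat).
  by case/orP=> ->; rewrite ?orbT.
have := @m_min (last x A) (size B) lF; rewrite B0 BM => /(_ isT).
have := dist_le_weight (last x A) B; rewrite -last_cat -eL.
move: IHA; rewrite eS !weight_cat -last_cat -eL !size_cat.
move: (weight _ _) (weight _ _) (weight _ _) => wD wB wA.
by move: (d (last x A) _) => dA; nia.
Qed.

End RationalTranslation.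

(* If geodesics from [x] to its [n]-th translate visit translates of a fixed
   finite set [F] in order, then the distance is up to a bounded error the
   minimal weight of a walk in a finite weighted digraph on [F], which grows
   like the minimal mean weight of a simple cycle. *)
Lemma rational_growth (T : eqType) (d : T -> T -> nat) (act : nat -> T -> T)
    (F : seq T) (x : T) (C : nat) :
  (forall x, d x x = 0) ->
  (forall x y z, d x z <= d x y + d y z) ->
  (forall i x y, d (act i x) (act i y) = d x y) ->
  (forall x, act 0 x = x) ->
  (forall i j x, act (i + j) x = act i (act j x)) ->
  (forall n, exists y s, [/\ size s = n, {subset y :: s <= F}
     & weight d act y s <= d x (act (n + C) x)]) ->
  exists m q K, 0 < q <= size F /\
    forall n, q * d x (act n x) <= m * n + K /\ m * n <= q * d x (act n x) + K.
Proof.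
move=> d_refl d_tri d_act act0 actD visit.
have F0 : 0 < size F.
  have [y [s [_ sF _]]] := visit 0; case: (F) (sF y) => //.
  by rewrite inE eqxx => /(_ isT).
(* The displacement rates of the points of [F] over at most [size F] periods; the smallest one
   becomes [m / q]. *)
pose fr := [seq (d b (act j.+1 b), j.+1) | b <- F, j <- iota 0 (size F)].
have [||p] := @min_fraction fr.
- by rewrite -size_eq0 size_allpairs size_iota; nia.
- by move=> p /allpairsP[[b j] [_ _ ->]].
case/allpairsP=> -[a j] [/= aF]; rewrite mem_iota /= add0n => jF -> pmin.
have mmin b i : b \in F -> 0 < i <= size F ->
    d a (act j.+1 a) * i <= d b (act i b) * j.+1.
  move=> bF /andP[i0 iF]; apply: (pmin (d b (act i b), i)); apply/allpairsP.
  by exists (b, i.-1); rewrite /= mem_iota prednK //; split=> //; lia.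
have [K hK] := orbit_upper d_refl d_tri d_act act0 actD a (ltn0Sn j) x.
exists (d a (act j.+1 a)), j.+1.
exists (K + d a (act j.+1 a) * (size F + C)); split; first by rewrite jF.
move=> n; split; first by have := hK n; lia.
have [nC|Cn] := leqP n C; first by nia.
have [y [s [sz sF]]] := visit (n - C); rewrite subnK ?(ltnW Cn) // => le.
have := weight_lower d_refl d_tri d_act act0 actD (ltn0Sn j) mmin sF.
by rewrite sz; nia.
Qed.

(** * Factorizations into star subgroups *)

Section Chains.
Variables (V : finType) (E : rel V).
Hypotheses (E_sym : symmetric E) (E_irr : irreflexive E).
(* [l i] is the generator at position [i] of a word of length [L]. *)
Variables (l : nat -> V) (L : nat).

(* The heap order on the positions of the word. *)
Inductive below : nat -> nat -> Prop :=
| below_refl i : below i i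
| below_step i j e : i < j -> ~~ E (l i) (l j) -> below j e -> below i e.

Lemma below_le i e : below i e -> i <= e.
Proof. by elim=> // {}i j {}e ij _ _ je; apply: leq_trans je; apply: ltnW. Qed.

Lemma below1 i e : i < e -> ~~ E (l i) (l e) -> below i e.
Proof. by move=> ie ne; apply: below_step ie ne (below_refl e). Qed.

Lemma below_trans i j e : below i j -> below j e -> below i e.
Proof. by elim=> // {}i k {}j ik n _ IH /IH; apply: below_step. Qed.

(* A chain describes a walk of length [N] in the extension graph: [vs] gives
   the labels of its vertices and the letter at position [j] belongs to the
   [k j]-th factor, an element of the star subgroup of [vs (k j)]. *)
Definition chain (vs : nat -> V) (k : nat -> nat) N :=
  [/\ forall i, i < N -> E (vs i) (vs i.+1),
      forall j, j < L -> k j <= N /\ star E (vs (k j)) (l j)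
    & forall i j, i < j < L -> ~~ E (l i) (l j) -> k i <= k j].

Lemma chain_below vs k N i j :
  chain vs k N -> below i j -> j < L -> k i <= k j.
Proof.
case=> _ _ mono; elim=> // {}i {}j e ij n je IH eL.
by apply: leq_trans (IH eL); apply: mono => //; have := below_le je; lia.
Qed.

(** Lexicographic minimality among chains with the same end labels: first the length, then the sum
    of the factor indices. *)
Definition minimal_chain vs k N := chain vs k N /\
  forall vs' k' N', chain vs' k' N' -> vs' 0 = vs 0 -> vs' N' = vs N ->
    N <= N' /\ (N' = N -> \sum_(j < L) k j <= \sum_(j < L) k' j).

Lemma minimal_chain_exists vs k N : chain vs k N ->
  (forall vs' k' N',
    chain vs' k' N' -> vs' 0 = vs 0 -> vs' N' = vs N -> N <= N') ->
  exists vs' k', [/\ minimal_chain vs' k' N, vs' 0 = vs 0 & vs' N = vs N].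
Proof.
move=> ch Nmin.
pose P s := `[< exists vs' k', [/\ chain vs' k' N, vs' 0 = vs 0, vs' N = vs N
                 & \sum_(j < L) k' j = s] >].
have ex : exists s, P s by exists (\sum_(j < L) k j); apply/asboolP;
  exists vs, k.
case: (ex_minnP ex) => s /asboolP[vs' [k' [ch' e0 eN es]]] smin.
exists vs', k'; split=> //; split=> // vs2 k2 N2 ch2; rewrite e0 eN => f0 fN.
split; first exact: Nmin ch2 f0 fN.
move=> e2; rewrite e2 in ch2 fN; rewrite es; apply: smin; apply/asboolP.
by exists vs2, k2.
Qed.

(** * Rerouting a chain through two letters *)

Section Reroute.
Variables (vs : nat -> V) (k : nat -> nat) (N e : nat).
Hypotheses (ch : chain vs k N) (eL : e < L).
Local Notation v := (l e).

(** A noncommuting letter before [e] would be below [e], and one after [e] could not lie in an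
    earlier factor. *)
Lemma reroute_incomparable j : j < L -> k j < k e -> ~ below j e -> E v (l j).
Proof.
move=> jL kj nb; apply: contraT => n.
case: (ltngtP j e) => [je|ej|eqje].
- by case: nb; apply: below1; rewrite // E_sym.
- by case: ch => _ _ /(_ e j) h; have := h _ n; rewrite ej jL => /(_ isT); lia.
- by move: kj; rewrite eqje ltnn.
Qed.

Lemma reroute_below x b : x < L -> ~ below x e -> below b e -> k x < k b ->
  E (l x) (l b).
Proof.
move=> xL nx be kxb; apply: contraT => n.
case: (ltngtP x b) => [xb|bx|eqxb].
- by case: nx; apply: below_step be.
- case: ch => _ _ /(_ b x) h; have := h _; rewrite bx xL => /(_ isT).
  by rewrite E_sym => /(_ n); lia.
- by move: kxb; rewrite eqxb ltnn.
Qed.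

Variable dd : nat.
Hypotheses (dL : dd < L) (kde : k dd < k e) (ndb : ~ below dd e).
Local Notation dl := (l dd).
Hypothesis Evw : E v (vs (k e)).

(* The walk from [vs (k dd)] to [vs (k e)] is replaced by one through [dl] and
   [v]; nothing is inserted before [dl] when [vs (k dd) = dl]. *)
Let o : nat := vs (k dd) != dl.

Definition reroute_walk i :=
  if i <= k dd then vs i
  else if i == k dd + o then dl
  else if i == k dd + o + 1 then v
  else vs (i - (k dd + o + 2) + k e).

(** In the replaced stretch, positions below [e] other than [e] commute with [dd] and go to the
    factor of [dl]. Those of factors before [k e] not below [e] commute with [e] and join it in the
    factor of [v]. The rest of factor [k e] stays at its vertex. *)
Definition reroute_factor x :=
  if k x <= k dd then k x
  else if k e < k x then k x - k e + (k dd + o + 2)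
  else if x == e then k dd + o + 1
  else if `[< below x e >] then k dd + o
  else if k x < k e then k dd + o + 1 else k dd + o + 2.

Lemma reroute_walk_start i : i <= k dd -> reroute_walk i = vs i.
Proof. by rewrite /reroute_walk => ->. Qed.

Lemma reroute_walk_dd : reroute_walk (k dd + o) = dl.
Proof.
rewrite /reroute_walk eqxx /o; case: (eqVneq (vs (k dd)) dl) => [<-|_] /=.
  by rewrite addn0 leqnn.
by rewrite ifF //; lia.
Qed.

Lemma reroute_walk_e : reroute_walk (k dd + o + 1) = v.
Proof.
rewrite /reroute_walk ifF; last by lia.
by rewrite ifF ?eqxx //; lia.
Qed.

Lemma reroute_walk_end i : reroute_walk (k dd + o + 2 + i) = vs (k e + i).
Proof.
rewrite /reroute_walk ifF; last by lia.
rewrite ifF; last by lia.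
by rewrite ifF; [rewrite addKn addnC|lia].
Qed.

Lemma reroute_chain :
  chain reroute_walk reroute_factor (N - k e + (k dd + o + 2)).
Proof.
case: (ch) => vsE kl mono; have [keN _] := kl e eL.
have Evd : E v dl by apply: reroute_incomparable.
have [_ sd] := kl dd dL.
split.
- move=> i iN.
  have [id|di] : i < k dd \/ k dd <= i by lia.
    by rewrite !reroute_walk_start ?(ltnW id) //; apply: vsE; lia.
  have [->|nid] := eqVneq i (k dd).
    rewrite reroute_walk_start //.
    have [zd|nzd] := eqVneq (vs (k dd)) dl.
      have o0 : o = 0 by rewrite /o zd eqxx.
      by have := reroute_walk_e; rewrite o0 addn0 addn1 => ->; rewrite zd E_sym.
    have o1 : o = 1 by rewrite /o nzd.
    have := reroute_walk_dd; rewrite o1 addn1 => ->.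
    by case/orP: sd => // /eqP dv; rewrite dv eqxx in nzd.
  have [->|no] := eqVneq i (k dd + o).
    by rewrite -addn1 reroute_walk_dd reroute_walk_e E_sym.
  have [->|no1] := eqVneq i (k dd + o + 1).
    rewrite reroute_walk_e -addn1 -addnA -[_ + (1 + 1)]addn0.
    by rewrite reroute_walk_end addn0.
  have [t it] : exists t, i = k dd + o + 2 + t.
    by exists (i - (k dd + o + 2)); lia.
  rewrite it -[(_ + t).+1]addnS !reroute_walk_end addnS; apply: vsE; lia.
- move=> j jL; have [kjN sj] := kl j jL; rewrite /reroute_factor.
  have [jd|dj] : k j <= k dd \/ k dd < k j by lia.
    by rewrite jd; split; [lia|rewrite /reroute_walk jd].
  rewrite ifF; last by lia.
  have [je|ej] : k e < k j \/ k j <= k e by lia.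
    rewrite je; split; first by lia.
    rewrite addnC reroute_walk_end.
    by have -> : k e + (k j - k e) = k j by lia.
  rewrite ifF; last by lia.
  have [->|nje] := eqVneq j e.
    by split; [lia|rewrite reroute_walk_e /star eqxx].
  case: asboolP => [bj|nbj].
    split; [lia|rewrite reroute_walk_dd /star].
    by rewrite (reroute_below dL ndb bj dj) orbT.
  have [kje|kej] := ltnP (k j) (k e).
    split; [lia|rewrite reroute_walk_e /star].
    by rewrite (reroute_incomparable jL kje nbj) orbT.
  split; first by lia.
  by rewrite -[_ + 2]addn0 reroute_walk_end addn0; have -> : k e = k j by lia.
- move=> i j /andP[ij jL] n; have mij := mono i j; rewrite ij jL in mij.
  have {mij} kij := mij isT n.
  have ie : j = e -> below i e /\ i != e.
    by move=> je; rewrite -je; split; [apply: below1|lia].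
  have bi : below j e -> below i e /\ i != e.
    move=> bj; split; first by apply: below_step bj.
    by have := below_le bj; lia.
  rewrite /reroute_factor.
  (* A noncommuting predecessor of a position below [e] is again below [e] and different from [e],
     so no such pair is reversed between the factors of [dl] and [v]. *)
  case: (asboolP (below i e)) => [_|nbi];
    case: (asboolP (below j e)) => [bj|nbj].
  + by have [_ nie] := bi bj; clear -nie kij kde; do ![case: ifP]; lia.
  + have nje : j != e by apply/eqP => je; apply: nbj; rewrite je;
    apply: below_refl.
    have [ie'|nie] := eqVneq i e.
      by rewrite ie' in kij *; clear -nje kij kde; do ![case: ifP]; lia.
    by clear -nie nje kij kde; do ![case: ifP]; lia.
  + by have [] := bi bj.
  have nje : j != e by apply/eqP => je; apply: nbj; rewrite je;
    apply: below_refl.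
  have nie : i = e -> k e < k j \/ k j = k e by move=> ie'; move: kij;
    rewrite ie'; clear; lia.
  have kje : ~~ (k j < k e) \/ k i < k e by clear -kij; lia.
  by clear -nje kij kde nie kje; do ![case: ifP]; lia.
Qed.

Lemma reroute_ends :
  reroute_walk 0 = vs 0 /\ reroute_walk (N - k e + (k dd + o + 2)) = vs N.
Proof.
case: (ch) => _ kl _; have [keN _] := kl e eL.
split=> //; rewrite addnC reroute_walk_end.
by congr (vs _); lia.
Qed.

End Reroute.

(** Every noncommuting predecessor of a position below [e] is below [e] too, so moving them back to
    factor [p] together keeps the order. *)
Lemma move_chain vs k N e p : chain vs k N -> p < k e -> e < L ->
  (forall b, b < L -> below b e -> p < k b -> l b = vs p) ->
  chain vs (fun x => if `[< below x e >] && (p < k x) then p else k x) N.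
Proof.
case=> vsE kl mono pe eL hb; have [keN _] := kl e eL; split=> //.
  move=> j jL; have [kjN sj] := kl j jL; case: asboolP => //= bj.
  by case: ltnP => // pj; split; [lia|rewrite /star (hb j jL bj pj) eqxx].
move=> i j /andP[ij jL] n; have := mono i j; rewrite ij jL => /(_ isT n) kij.
case: (asboolP (below j e)) => [bj|nbj] /=.
  have /asboolP -> : below i e by apply: below_step bj.
  by do ![case: ifP]; lia.
by do ![case: ifP]; lia.
Qed.

(** * Minimal chains without cycles of length at most five *)

Hypothesis no_triangle : forall a b c, E a b -> E b c -> E c a -> False.
Hypothesis no_square : forall a b c d,
  E a b -> E b c -> E c d -> E d a -> (a = c) \/ (b = d).
Hypothesis no_pentagon : forall a b c d e,
  E a b -> E b c -> E c d -> E d e -> E e a -> False.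

(** A violating position allows a reroute of two or three edges from its factor to that of [e].
    Minimality bounds the gap between the factors by that number, and each remaining gap gives a
    short cycle or a smaller sum. *)
Lemma minimal_chain_label vs k N e j : minimal_chain vs k N ->
  e < L -> vs (k e) <> l e -> j < L -> k j < k e -> ~ below j e ->
  l j = vs (k e).
Proof.
case=> ch mn eL nwv jL kj nb; apply/eqP; apply: contraT => nl.
suff : False by [].
case: (ch) => vsE kl mono; have [keN se] := kl e eL.
have Evw : E (l e) (vs (k e)).
  by rewrite E_sym; case/orP: se => // /eqP h; case: nwv.
pose bad (x : 'I_L) := [&& k x < k e, l x != vs (k e) & ~~ `[< below x e >]].
have bad0 : bad (Ordinal jL).
  by rewrite /bad /= kj nl /=; apply/asboolPn.
(* Take a violating position in the last possible factor: positions in factors strictly between it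
   and [e] are then below [e] or labelled [vs (k e)]. *)
case: (arg_maxnP (fun x : 'I_L => k x) bad0) => -[dd dL] /=.
move=> /and3P[/= kd nld /asboolPn nbd] dmax {j jL kj nl nb bad0}.
have good x : x < L -> k dd < k x < k e -> ~ below x e -> l x = vs (k e).
  move=> xL /andP[dx xe] nbx; apply/eqP; apply: contraT => nlx.
  have := dmax (Ordinal xL); rewrite /bad /= xe nlx /=.
  by have /asboolPn -> := nbx => /(_ isT); rewrite leqNgt dx.
have Evd := reroute_incomparable ch eL dL kd nbd.
have rch := reroute_chain ch eL dL kd nbd Evw.
have [r0 rN] := reroute_ends ch eL dL kd Evw.
have [Nle sle] := mn _ _ _ rch r0 rN.
have [_ sd] := kl dd dL.
have sum_lt k' : (forall x, x < L -> k' x <= k x) -> k' e < k e ->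
    \sum_(x < L) k x <= \sum_(x < L) k' x -> False.
  move=> le lt; rewrite leqNgt => /negP; apply.
  rewrite (bigD1 (Ordinal eL)) //= [ltnRHS](bigD1 (Ordinal eL)) //=.
  by rewrite -addSn leq_add // leq_sum // => x _; apply: le.
(* The positions below [e] that keep it from moving to the factor of [dd] are
   all labelled [l e], so they can move along, which decreases the sum. *)
have moves : vs (k dd) = l e -> (forall b, b < L -> below b e -> k dd < k b ->
    E (vs (k e)) (l b) \/ l b = vs (k e)) -> False.
  move=> zv hb; have lb b : b < L -> below b e -> k dd < k b -> l b = vs (k dd).
    move=> bL be kb; rewrite zv.
    have Edb := reroute_below ch eL dL nbd be kb.
    case: (hb b bL be kb) => [Ewb|lbw].
      rewrite E_sym in Ewb; rewrite E_sym in Evw; rewrite E_sym in Edb.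
      case: (no_square Ewb Evw Evd) => //; first by rewrite E_sym.
      by move=> wd; rewrite wd eqxx in nld.
    rewrite lbw in Edb.
    by case: (no_triangle (a := l e) (b := vs (k e)) (c := l dd));
      rewrite // E_sym.
  have mch := move_chain ch kd eL lb.
  have [_ /(_ erefl) le] := mn _ _ _ mch erefl erefl.
  refine (sum_lt (fun x =>
    if `[< below x e >] && (k dd < k x) then k dd else k x)
    _ _ le) => [x _|/=].
    by case: ifP => // /andP[_ /ltnW].
  by have /asboolP -> := below_refl e; rewrite kd.
have Edl := no_triangle (a := l e) (b := vs (k e)) (c := l dd) Evw.
(* If the vertex of [dd] has its label, the reroute has two edges: a gap of one gives a triangle, a
   gap of two an equally long chain with smaller sum. *)
have [zd|nzd] := eqVneq (vs (k dd)) (l dd).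
  have o0 : (vs (k dd) != l dd) = 0 :> nat by rewrite zd eqxx.
  have [n1|n2] : k e = (k dd).+1 \/ k e = (k dd).+2 by clear -kd Nle keN o0;
    lia.
    apply: Edl; last by rewrite E_sym.
    by rewrite E_sym n1 -zd; apply: vsE; clear -n1 keN; lia.
  case: (sum_lt (reroute_factor vs k e dd)); last first.
    by apply: sle; clear -n2 keN o0; lia.
    by rewrite /reroute_factor o0 eqxx; clear -n2; do ![case: ifP => //]; lia.
  move=> x xL; rewrite /reroute_factor o0.
  by clear -n2; do ![case: ifP => //]; lia.
have o1 : (vs (k dd) != l dd) = 1 :> nat by rewrite nzd.
have Ezd : E (vs (k dd)) (l dd).
  by case/orP: sd => // /eqP h; rewrite h eqxx in nzd.
have Edv : E (l dd) (l e) by rewrite E_sym.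
(* The closed walk [vs (k dd)], [vs (k e)], [l e], [l dd] must degenerate, and [vs (k e)] differs
   from [l dd]. *)
have square : E (vs (k dd)) (vs (k e)) -> vs (k dd) = l e.
  move=> Ezw; case: (no_square Ezw (_ : E _ (l e)) Evd); rewrite 1?E_sym //.
  by move=> wd; rewrite wd eqxx in nld.
have [n1|[n2|n3]] : k e = (k dd).+1 \/ k e = (k dd).+2 \/ k e = (k dd).+3
  by clear -kd Nle keN o1; lia.
- have Ezw : E (vs (k dd)) (vs (k e)) by rewrite n1; apply: vsE;
  clear -n1 keN; lia.
  apply: moves (square Ezw) _ => b bL be kb.
  have kbe := chain_below ch be eL.
  have [_] := kl b bL; have -> : k b = k e by clear -kbe kb n1; lia.
  by case/orP=> [/eqP ->|]; [right|left].
- case: (no_pentagon (a := vs (k dd)) (b := vs (k dd).+1) (c := vs (k e))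
    (d := l e) (e := l dd)) => //; try by rewrite E_sym.
  + by apply: vsE; clear -n2 keN; lia.
  + by rewrite n2; apply: vsE; clear -n2 keN; lia.
have E01 : E (vs (k dd)) (vs (k dd).+1) by apply: vsE; clear -n3 keN; lia.
have E12 : E (vs (k dd).+1) (vs (k dd).+2) by apply: vsE; clear -n3 keN; lia.
have E23 : E (vs (k dd).+2) (vs (k e)) by rewrite n3; apply: vsE;
  clear -n3 keN; lia.
(* For a gap of three, a position of factor [(k dd).+1] not below [e] forces the label there to be
   [vs (k e)], and the square applies. Without such a position the reroute raises no index and
   lowers that of [e]. *)
have [/existsP[[x xL] /= /andP[/eqP kx /asboolPn nx]]|nex] :=
    boolP [exists x : 'I_L, (k x == (k dd).+1) && ~~ `[< below x e >]].
  have lx : l x = vs (k e) by apply: good => //; clear -kx n3; lia.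
  have m1w : vs (k dd).+1 = vs (k e).
    apply/eqP; apply: contraT => nm1.
    have [_] := kl x xL; rewrite kx lx /star eq_sym (negPf nm1) /= => E1w.
    by case: (no_triangle E12 E23); rewrite E_sym.
  have Ezw : E (vs (k dd)) (vs (k e)) by rewrite -m1w.
  apply: moves (square Ezw) _ => b bL be kb.
  have [kb1|kb1] : k b = (k dd).+1 \/ k x < k b by clear -kx kb; lia.
    have [_] := kl b bL; rewrite kb1 m1w.
    by case/orP=> [/eqP ->|]; [right|left].
  by left; rewrite -lx; exact: (reroute_below ch eL xL nx be kb1).
case: (sum_lt (reroute_factor vs k e dd)); last first.
  by apply: sle; clear -n3 keN o1; lia.
  by rewrite /reroute_factor o1 eqxx; clear -n3; do ![case: ifP => //]; lia.
move=> x xL; rewrite /reroute_factor o1.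
have : `[< below x e >] || (k x != (k dd).+1).
  apply: contraR nex; rewrite negb_or negbK => /andP[nb kx].
  by apply/existsP; exists (Ordinal xL); rewrite /= kx nb.
have [->|_] := eqVneq x e; first by clear -n3; do ![case: ifP => //]; lia.
case: `[< below x e >] => /=; clear -n3; first by do ![case: ifP => //]; lia.
by do ![case: ifP => //]; lia.
Qed.

End Chains.

(** * Powers of a cyclically reduced word *)

Lemma below_shift (V : finType) (E : rel V) (l : nat -> V) s :
  (forall i, l (s + i)%N = l i) ->
  forall i e, below E l (s + i)%N (s + e)%N <-> below E l i e.
Proof.
move=> ls i e; split.
  have gen x y : below E l x y ->
      forall i' e', (s + i' = x)%N -> (s + e' = y)%N -> below E l i' e'.
    elim=> {x y} [x i' e' <- /addnI ->|x y z xy n _ IH i' e' ix ez].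
      exact: below_refl.
    have [j jy] : exists j, (s + j = y)%N by exists (y - s)%N; lia.
    apply: below_step (IH j e' jy ez); first by lia.
    by rewrite -(ls i') -(ls j) ix jy.
  by move=> h; apply: gen h _ _ _ _.
elim=> {i e} [i|i j e ij n _]; first exact: below_refl.
by apply: below_step; rewrite ?ltn_add2l // !ls.
Qed.

Section Periodic.
Local Open Scope group_scope.
Variables (V : finType) (E : rel V).
Hypotheses (E_sym : symmetric E) (E_irr : irreflexive E).
Hypothesis E_conn : forall u v : V, connect E u v.

Local Notation cls := (cls E).
Local Notation star := (star E).
Local Notation star_word := (star_word E).
Local Notation d := (gdist (@ext_edge _ E)).

(** Each letter of [P] commutes with the earlier letters of [R] outside [P], so it can be moved in
    front of them. *)
Lemma cls_split (T : eqType) (f : T -> V * bool) (s : seq T) (P R : pred T) :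
  subpred P R ->
  pairwise (fun x y => [&& R x, ~~ P x & P y] ==> comm E (f x) (f y)) s ->
  cls [seq f x | x <- s & R x] =
  cls [seq f x | x <- s & P x] * cls [seq f x | x <- s & R x && ~~ P x].
Proof.
move=> PR; elim: s => [|x s IH] /=; first by rewrite mulg1.
move=> /andP[/allP cx /IH{}IH].
have [Px|nPx] := boolP (P x).
  by rewrite PR //= !(cls_cons _ _ (map f _)) IH mulgA.
case Rx: (R x) => //=; rewrite !(cls_cons _ _ (map f _)) IH !mulgA;
  congr (_ * _).
suff : all (comm E (f x)) [seq f y | y <- s & P y].
  elim: [seq f y | y <- s & P y] => [|b r IHr /= /andP[cb /IHr c]].
    by rewrite cls_nil mulg1 mul1g.
  by rewrite (cls_cons _ b) mulgA (cls_comm cb) -mulgA c mulgA.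
apply/allP=> _ /mapP[y + ->]; rewrite mem_filter => /andP[Py ys].
by have := cx y ys; rewrite Rx nPx Py.
Qed.

Variables (u : word V) (a0 : V * bool).
Hypothesis u_gt0 : (0 < size u)%N.
Local Notation p := (size u).
Local Notation f := (cls u).

Definition lam j := nth a0 u (j %% p).
Definition lab j := (lam j).1.

Lemma lam_shift i j : lam (i * p + j) = lam j.
Proof. by rewrite /lam modnMDl. Qed.

Lemma lab_shift i j : lab (i * p + j) = lab j.
Proof. by rewrite /lab lam_shift. Qed.

Lemma cls_period n : cls [seq lam j | j <- iota 0 (n * p)] = f ^+ n.
Proof.
elim: n => [|n IH]; first by rewrite mul0n cls_nil expg0.
rewrite mulSn iotaD map_cat cls_cat expgS; congr (_ * _).
  congr cls; apply: (@eq_from_nth _ a0); first by rewrite size_map size_iota.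
  move=> i; rewrite size_map size_iota => ip.
  by rewrite (nth_map 0%N) ?size_iota // nth_iota // /lam modn_small.
rewrite add0n -[X in iota X]addn0 iotaDl -map_comp -IH; congr cls.
by apply: eq_map => j /=; rewrite -[X in (X + _)%N]mul1n lam_shift.
Qed.

Definition part L (P : pred nat) := cls [seq lam j | j <- iota 0 L & P j].

Lemma part_split L (P R : pred nat) : subpred P R ->
  (forall i j, (i < j < L)%N -> ~~ E (lab i) (lab j) -> P j -> P i) ->
  part L R = part L P * part L (fun j => R j && ~~ P j).
Proof.
move=> PR down; apply: cls_split => //.
have : sorted ltn (iota 0 L) by apply: iota_ltn_sorted.
rewrite sorted_pairwise; last exact: ltn_trans.
apply: sub_in_pairwise (allss _) => i j _; rewrite mem_iota add0n => jL ij.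
apply/implyP=> /and3P[_ nPi Pj]; apply: contraNT nPi => n.
by apply: down Pj => //; move: ij jL => /= ->.
Qed.

Lemma part_star L (P : pred nat) v :
  (forall j, (j < L)%N -> P j -> star v (lab j)) ->
  exists2 s, star_word v s & part L P = cls s.
Proof.
move=> h; eexists; last by [].
apply/allP=> _ /mapP[j + ->]; rewrite mem_filter mem_iota add0n => /andP[Pj jL].
exact: h.
Qed.

(** The full periods before the window contribute a power of [f], so up to translation only the
    finite window matters. *)
Lemma part_window L (P : pred nat) i m : (i * p + m <= L)%N ->
  (forall j, (j < i * p)%N -> P j) ->
  (forall j, (i * p + m <= j < L)%N -> ~~ P j) ->
  part L P = f ^+ i * cls [seq lam j | j <- iota 0 m & P (i * p + j)].
Proof.
move=> /subnKC <-; move: (L - _)%N => r Pl Pr.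
rewrite /part !iotaD !filter_cat !map_cat !cls_cat add0n.
have -> : [seq j <- iota 0 (i * p) | P j] = iota 0 (i * p).
  by apply/all_filterP/allP=> j; rewrite mem_iota add0n => /Pl.
rewrite cls_period.
have -> : [seq j <- iota (i * p + m) r | P j] = [::].
  apply/eqP; rewrite -[_ == _]negbK -has_filter; apply/negP=> /hasP[j].
  by rewrite mem_iota => jr; apply/negP/Pr; lia.
rewrite cls_nil mulg1; congr (_ * _).
rewrite -[X in iota X]addn0 iotaDl filter_map -map_comp.
by congr cls; apply: eq_map => j /=; rewrite lam_shift.
Qed.

Lemma part_chain L vs k N : chain E lab L vs k N ->
  forall i j, (i <= j <= N)%N ->
  (d (vtx (part L (fun x => k x < i)%N) (vs i))
     (vtx (part L (fun x => k x < j)%N) (vs j)) <= j - i)%N.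
Proof.
case=> vsE kl mono.
refine (@gdist_chain _ _ E_sym E_irr vs (fun i => part L (fun x =>
  k x < i)%N) N _).
move=> i iN; split; first exact: vsE.
have [|s ss sE] := @part_star L (fun x => k x == i) (vs i).
  by move=> j jL /eqP <-; have [] := kl j jL.
exists s; rewrite // -sE (@part_split L (fun x => k x < i)%N).
- congr (_ * cls _); congr map; apply: eq_filter => x; lia.
- by move=> x /= xi; rewrite ltnS ltnW.
- by move=> x y xy n; apply: leq_ltn_trans; apply: mono.
Qed.

(** Enlarging the prefix by letters in the star of [vs i] multiplies the group element by one that
    fixes the vertex. *)
Lemma part_vtx L vs k N i (J : pred nat) : chain E lab L vs k N ->
  (forall j, k j < i -> J j)%N ->
  (forall j, (j < L)%N -> J j -> ~~ (k j < i)%N -> star (vs i) (lab j)) ->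
  vtx (part L (fun x => k x < i)%N) (vs i) = vtx (part L J) (vs i).
Proof.
case=> vsE kl mono IJ Js.
have [|s ss sE] := @part_star L (fun j => J j && ~~ (k j < i)%N) (vs i).
  by move=> j jL /andP[]; apply: Js.
rewrite (@part_split L (fun x => k x < i)%N J) //.
  by rewrite sE vtx_star.
by move=> x y xy n; apply: leq_ltn_trans; apply: mono.
Qed.

Hypothesis power_reduced :
  forall n, reduced E [seq lam j | j <- iota 0 (n * p)].

Lemma chain_of_walk n v w N :
  is_walk_length (@ext_edge _ E) (vtx 1%g v) (vtx (f ^+ n)%g w) N ->
  exists vs k, [/\ chain E lab (n * p) vs k N, vs 0%N = v & vs N = w].
Proof.
move=> /(walkn_chain E_sym E_irr)[vs [A [v0 vN vE [pA sA]]]].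
rewrite invg1 mul1g -cls_period.
move=> /(reduced_tags E_sym E_irr pA (power_reduced n))[T [eT sT pT]].
pose k j := (nth (a0, 0%N) T j).2.
have szT : size T = (n * p)%N by rewrite -(size_map fst) eT size_map size_iota.
have labT j : (j < n * p)%N -> (nth (a0, 0%N) T j).1.1 = lab j.
  move=> jL; rewrite -(nth_map _ a0 fst) ?szT // eT.
  by rewrite (nth_map 0%N) ?size_iota // nth_iota.
exists vs, k; split=> //; split=> //.
  move=> j jL; have [|? ?] := sA (nth (a0, 0%N) T j).
    by apply: sT; rewrite mem_nth // szT.
  by rewrite -labT.
move=> i j /andP[ij jL] nij.
have := pairwiseP (a0, 0%N) pT; rewrite szT => /(_ i j).
rewrite !inE (ltn_trans ij jL) jL ij /comm !labT ?(ltn_trans ij jL) //.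
by rewrite (negPf nij) /=; apply.
Qed.

Lemma chain_gdist n vs k N : chain E lab (n * p) vs k N ->
  (d (vtx 1%g (vs 0)) (vtx (f ^+ n)%g (vs N)) <= N)%N.
Proof.
move=> ch; have := part_chain ch (i := 0) (j := N); rewrite !leqnn subn0.
move=> /(_ isT).
rewrite (@part_vtx _ _ _ _ N predT ch) //; last first.
  move=> j jL _; rewrite -leqNgt => Nk; have [_ kl _] := ch.
  by have [kN ] := kl j jL; have -> : k j = N by lia.
rewrite [part _ predT](_ : _ = f ^+ n); last first.
  by rewrite /part filter_predT cls_period.
rewrite [part _ _](_ : _ = 1) //.
by rewrite /part filter_pred0.
Qed.

Definition act (i : nat) (x : ext_vertex E) := ext_act x (f ^- i).

Lemma act_vtx i h v : act i (vtx h v) = vtx (f ^+ i * h) v.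
Proof. by rewrite /act ext_act_vtx invgK. Qed.

Local Notation point L vs k i := (vtx (part L (fun x => k x < i)%N) (vs i)).

Lemma weight_iota (b : nat -> ext_vertex E) (K : nat -> nat) n :
  (forall i, i < n -> K i <= K i.+1 /\
     d (act i (b i)) (act i.+1 (b i.+1)) <= K i.+1 - K i)%N ->
  (weight d act (b 0) [seq b i | i <- iota 1 n] <= K n - K 0)%N.
Proof.
elim: n => [|n IH] h; first by rewrite /weight.
have {}IH := IH (fun i ni => h i (ltnW ni)).
have K0 : (K 0 <= K n)%N.
  elim: (n) h {IH} => // m IHm h; apply: (@leq_trans (K m)).
    by apply: IHm => i im; apply: h; apply: ltnW.
  by have [] := h m (ltnW (ltnSn _)).
rewrite -[n.+1]addn1 iotaD map_cat weight_cat /= add1n addn1.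
have -> : last (b 0) [seq b i | i <- iota 1 n] = b n.
  by case: (n) => // m; rewrite -[m.+1]addn1 iotaD map_cat last_cat /= addnC.
have [Kn] := h n (ltnSn n).
have -> : act n.+1 (b n.+1) = act n (act 1 (b n.+1)).
  have [h' [v ->]] := ext_vertexP (b n.+1).
  by rewrite !act_vtx mulgA expg1 -expgSr.
rewrite gdist_act // => dn; rewrite [weight _ _ (b n) _]/weight /= addn0; lia.
Qed.

(** The pieces of the geodesic between successive visited points add up to at most its length, as
    [rational_growth] demands. *)
Lemma power_growth (v0 : V) (F : seq (ext_vertex E)) (c C : nat) :
  (forall n, exists vs k N,
     [/\ chain E lab ((n + C) * p) vs k N, vs 0%N = v0, vs N = v0
       & (N <= d (vtx 1%g v0) (vtx (f ^+ (n + C))%g v0))%N /\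
     forall i, (i <= n)%N -> (c + i < n + C)%N /\ exists2 b, b \in F
       & point ((n + C) * p) vs k (k ((c + i) * p)%N) = act i b]) ->
  exists m q K, (0 < q <= size F)%N /\
    forall n, (q * d (vtx 1%g v0) (vtx (f ^+ n)%g v0) <= m * n + K /\
               m * n <= q * d (vtx 1%g v0) (vtx (f ^+ n)%g v0) + K)%N.
Proof.
move=> visit.
have [|||||n|m [q [K [qF hK]]]] := @rational_growth _ d act F (vtx 1%g v0) C.
- by move=> x; apply/eqP; rewrite -leqn0; apply: gdist_le; apply: walkn0.
- exact: gdist_triangle.
- by move=> i x y; apply: gdist_act.
- by move=> x; have [h [v ->]] := ext_vertexP x; rewrite act_vtx expg0 mul1g.
- move=> i j x; have [h [v ->]] := ext_vertexP x.
  by rewrite !act_vtx mulgA -expgnDr.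
- have [vs [k [N [ch vs0 vsN [Nd hv]]]]] := visit n.
  have hv' i : exists b, (i <= n)%N -> b \in F /\
      point ((n + C) * p) vs k (k ((c + i) * p)%N) = act i b.
    have [i_n|] := leqP i n; last by exists (vtx 1%g v0).
    by have [_ [b bF eb]] := hv i i_n; exists b.
  have [b hb] := boolp.choice hv'.
  exists (b 0%N), [seq b i | i <- iota 1 n]; split.
  + by rewrite size_map size_iota.
  + move=> x; rewrite inE => /orP[/eqP->|/mapP[i + ->]];
    first by have [] := hb 0%N isT.
    by rewrite mem_iota => i_n; have [|] := hb i; first lia.
  rewrite act_vtx mulg1; apply: leq_trans Nd.
  have eL i : (i <= n)%N -> ((c + i) * p < (n + C) * p)%N.
    by move=> i_n; rewrite ltn_pmul2r //; have [] := hv i i_n.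
  case: (ch) => _ kl mono.
  apply: leq_trans (weight_iota (K := fun i => k ((c + i) * p)%N) _) _;
    last first.
    by have [] := kl _ (eL n (leqnn n)); lia.
  move=> i i_n.
  (* Equal letters in different periods are comparable in the heap, so their factors come in
     order. *)
  have kk : (k ((c + i) * p) <= k ((c + i.+1) * p))%N.
    apply: mono; first by rewrite eL // andbT ltn_pmul2r //; lia.
    by rewrite -[(_ * p)%N]addn0 -[((c + i.+1) * p)%N]addn0 !lab_shift E_irr.
  split=> //.
  have [_ <-] := hb i (ltnW i_n); have [_ <-] := hb i.+1 i_n.
  by apply: (part_chain ch); rewrite kk; have [] := kl _ (eL _ i_n).
by exists m, q, K; split=> // n; have := hK n; rewrite act_vtx mulg1.
Qed.

(** * Cyclic words whose support is not a join *)

Hypothesis u_connected : forall a b : V, a \in map fst u -> b \in map fst u ->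
  connect (fun x y => ~~ E x y && (y \in map fst u)) a b.

Lemma lab_letter j : lab j \in map fst u.
Proof. by apply: (map_f fst); rewrite mem_nth // ltn_mod. Qed.

Lemma next_letter e y : y \in map fst u ->
  exists e', (e < e' <= e + p)%N /\ lab e' = y.
Proof.
move=> /mapP[b bu ->]; set t := index b u.
have tp : (t < p)%N by rewrite index_mem.
have lt i : lab (i * p + t) = b.1.
  by rewrite lab_shift /lab /lam modn_small // nth_index.
have e1 := divn_eq e p; have e2 := ltn_pmod e u_gt0.
have [te|et] := leqP t (e %% p).
  by exists ((e %/ p).+1 * p + t)%N; rewrite lt; split=> //; lia.
by exists ((e %/ p) * p + t)%N; rewrite lt; split=> //; lia.
Qed.

(** Follow a simple path in the complement graph of the support from the label of [e] to that of
    [j]: each of its fewer than [#|V|] edges advances by at most one period, and equal labels are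
    comparable. *)
Lemma below_far e j : (e + #|V| * p <= j)%N -> below E lab e j.
Proof.
move=> ej;
  have /connectP[q0 q0p lq0] := u_connected (lab_letter e) (lab_letter j).
case/shortenP: q0p lq0 => q qp qu _ lq.
have qV : (size q < #|V|)%N
  by rewrite -[_.+1]/(size (lab e :: q)) -(card_uniqP qu) max_card.
have [e' [be e'q le']] : exists e', [/\ below E lab e e',
    (e' <= e + size q * p)%N & lab e' = lab j].
  elim: q e qp lq {ej q0 qu qV} => [|y q IH] e /=.
    by move=> _ ->; exists e; rewrite addn0; split=> //; apply: below_refl.
  move=> /andP[/andP[ne yu] qp] lq.
  have [e1 [e1e le1]] := next_letter e yu; rewrite -le1 in qp lq ne.
  have [e' [be e'q le']] := IH e1 qp lq; exists e'; split=> //; last first.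
    by move: e1e => /andP[_ h]; rewrite mulSn addnA; apply: leq_trans e'q _;
      rewrite leq_add2r.
  by apply: below_step ne be; lia.
have [ee|je] := eqVneq e' j; first by rewrite -ee.
apply: below_trans be (below1 _ _); first by nia.
by rewrite le' E_irr.
Qed.

Lemma geodesic_chain n v0 : exists vs k N,
  [/\ chain E lab (n * p) vs k N, vs 0%N = v0, vs N = v0
    & N = d (vtx 1%g v0) (vtx (f ^+ n)%g v0)].
Proof.
have := gdist_walk E_sym E_irr E_conn (vtx 1%g v0) (vtx (f ^+ n)%g v0).
by move=> /chain_of_walk[vs [k [ch h0 hN]]];
  exists vs, k, (d (vtx 1%g v0) (vtx (f ^+ n)%g v0)).
Qed.

(* Positions below [e] outside the earlier factors lie in the factor of [e]
   itself, so including them does not change the vertex. *)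
Lemma point_below L vs k N e : chain E lab L vs k N -> (e < L)%N ->
  point L vs k (k e) =
  vtx (part L (fun j => (k j < k e)%N || (j != e) && `[< below E lab j e >]))
      (vs (k e)).
Proof.
move=> ch eL; apply: (part_vtx ch) => [j ->//|j jL].
case: ltnP => //= kej /andP[_ /asboolP be] _.
have kje := chain_below ch be eL; case: ch => _ /(_ j jL)[_].
by have -> : k j = k e by apply/eqP; rewrite eqn_leq kje kej.
Qed.

(** Positions at least [#|V|] periods before [e] are below [e], and [e] is below those that far
    after it; only the [2 * #|V|] periods between are undetermined. *)
Lemma point_window n vs k N i : chain E lab (n * p) vs k N ->
  (#|V| + i + #|V| <= n)%N -> (0 < #|V|)%N ->
  exists2 w, size w = (2 * #|V| * p)%N &
  point (n * p) vs k (k ((#|V| + i) * p)%N) =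
  act i (vtx (cls (mask w [seq lam j | j <- iota 0 (2 * #|V| * p)]))
             (vs (k ((#|V| + i) * p)%N))).
Proof.
move=> ch i_n V0; set e := ((#|V| + i) * p)%N; have eL : (e < n * p)%N.
  by rewrite ltn_pmul2r //; lia.
pose J j := (k j < k e)%N || (j != e) && `[< below E lab j e >].
exists [seq J (i * p + j)%N | j <- iota 0 (2 * #|V| * p)].
  by rewrite size_map size_iota.
rewrite (point_below ch eL) act_vtx -map_mask -filter_mask.
rewrite (@part_window _ _ i (2 * #|V| * p)) //.
- by rewrite -mulnDl leq_pmul2r //; lia.
- move=> j ji; apply/orP; right; rewrite /e; apply/andP; split; first by nia.
  by apply/asboolP/below_far; nia.
move=> j /andP[ej jL]; have ee : (e + #|V| * p <= j)%N by rewrite /e; nia.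
rewrite negb_or -leqNgt (chain_below ch (below_far ee) jL) /= negb_and.
by apply/orP; right; apply/asboolPn => /below_le; nia.
Qed.

End Periodic.

(** * Growth rates and their denominators *)

Section Growth.
Local Open Scope group_scope.
Variables (V : finType) (E : rel V).
Hypotheses (E_sym : symmetric E) (E_irr : irreflexive E).
Hypothesis E_conn : forall u v : V, connect E u v.

Local Notation cls := (cls E).
Local Notation star := (star E).
Local Notation d := (gdist (@ext_edge _ E)).

Definition linear_growth (D : nat -> nat) (m q : nat) :=
  exists K, forall n, (q * D n <= m * n + K /\ m * n <= q * D n + K)%N.

Definition orbit_dist v f n := d (vtx (1%g : raag E) v) (vtx (f ^+ n)%g v).

Section Connected.
Variables (u : word V) (a0 : V * bool).
Hypothesis u_gt0 : (0 < size u)%N.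
Hypothesis power_reduced :
  forall n, reduced E [seq lam u a0 j | j <- iota 0 (n * size u)].
Hypothesis u_connected : forall a b : V, a \in map fst u -> b \in map fst u ->
  connect (fun x y => ~~ E x y && (y \in map fst u)) a b.
Local Notation p := (size u).
Local Notation c := #|V|.
Local Notation lam := (lam u a0).
Local Notation lab := (lab u a0).

Lemma V_gt0 : (0 < c)%N.
Proof. by apply/card_gt0P; exists a0.1. Qed.

Lemma connected_growth : exists m q,
  (0 < q)%N /\ linear_growth (orbit_dist a0.1 (cls u)) m q.
Proof.
(* All subwords of a window of [2 * c] periods, with every label, give a set [F] independent of
   [n]. *)
pose ws := [seq tval t | t <- enum {: (2 * c * p).-tuple bool}].
pose F := [seq vtx (cls (mask w [seq lam j | j <- iota 0 (2 * c * p)])) v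
  | w <- ws, v <- enum V].
have [n|m [q [K [/andP[q0 _] hK]]]] := @power_growth _ _ E_sym E_irr E_conn
    u a0 u_gt0 a0.1 F c (2 * c).+1; last by exists m, q; split=> //; exists K.
have [vs [k [N [ch h0 hN Nd]]]] := geodesic_chain E_sym E_irr E_conn
  power_reduced (n + (2 * c).+1) a0.1.
exists vs, k, N; split=> //; split; first by rewrite Nd.
move=> i i_n; split; first by lia.
have [||w sw ->] := point_window E_irr u_gt0 u_connected (i := i) ch.
- by lia.
- exact: V_gt0.
eexists; last by [].
apply/allpairsP; exists (w, vs (k ((c + i) * p)%N)); split=> //=.
  have st : size w == (2 * c * p)%N by apply/eqP.
  by apply/mapP; exists (Tuple st); rewrite ?mem_enum.
by rewrite mem_enum.
Qed.

Hypothesis no_triangle : forall a b c, E a b -> E b c -> E c a -> False.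
Hypothesis no_square : forall a b c d,
  E a b -> E b c -> E c d -> E d a -> (a = c) \/ (b = d).
Hypothesis no_pentagon : forall a b c d e,
  E a b -> E b c -> E c d -> E d e -> E e a -> False.

(** Letters of earlier factors not below [e] lie in the star of [vs (k e)]: they commute with [e] if
    that is the label of [e], and otherwise [minimal_chain_label] applies. *)
Lemma minimal_point L vs k N e : minimal_chain E lab L vs k N -> (e < L)%N ->
  vtx (part E u a0 L (fun j => k j < k e)%N) (vs (k e)) =
  vtx (part E u a0 L (fun j => (j != e) && `[< below E lab j e >])) (vs (k e)).
Proof.
move=> mch eL; have [ch _] := mch.
rewrite (point_below ch eL).
set B := fun j => (j != e) && `[< below E lab j e >].
rewrite (@part_split _ _ u a0 L B) =>
  [|j Bj|i j /andP[ij jL] n /andP[_ /asboolP be]].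
- have [|s ss ->] := @part_star _ E u a0 L
    (fun j => ((k j < k e)%N || B j) && ~~ B j) (vs (k e)).
    move=> j jL /andP[+ nB]; rewrite (negPf nB) orbF => kj.
    have nb : ~ below E lab j e.
      move=> be; move: nB; rewrite /B; case: eqVneq => [je|_] /=.
        by move: kj; rewrite je ltnn.
      by move=> /asboolPn.
    have [we|/eqP nwe] := eqVneq (vs (k e)) (lab e).
      by rewrite we /star (reroute_incomparable E_sym ch eL jL kj nb) orbT.
    have := minimal_chain_label E_sym no_triangle no_square no_pentagon
      mch eL nwe jL kj nb.
    by move=> ->; rewrite /star eqxx.
  by rewrite vtx_star.
- by apply/orP; right.
apply/andP; split; last by apply/asboolP; apply: below_step be.
by have := below_le be; lia.
Qed.

Lemma large_girth_growth : exists m q,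
  (0 < q <= c)%N /\ linear_growth (orbit_dist a0.1 (cls u)) m q.
Proof.
(* By periodicity the positions strictly below a later [e] form full periods followed by a copy of
   [r], so one point per label suffices. *)
pose r := [seq lam j | j <- iota 0 (c * p)
             & (j != c * p) && `[< below E lab j (c * p) >]]%N.
pose F := [seq vtx (cls r) v | v <- enum V].
have [n|m [q [K [qF hK]]]] := @power_growth _ _ E_sym E_irr E_conn
    u a0 u_gt0 a0.1 F c c.+1; last first.
  by exists m, q; split; [rewrite cardE -(size_map (vtx (cls r)))|exists K].
have [vs0 [k0 [N [ch0 h0 hN Nd]]]] := geodesic_chain E_sym E_irr E_conn
  power_reduced (n + c.+1) a0.1.
have [|vs [k [mch]]] := minimal_chain_exists ch0.
  move=> vs' k' N' ch'; rewrite h0 hN => e0 eN; rewrite Nd.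
  by have := chain_gdist E_sym E_irr u_gt0 ch'; rewrite e0 eN.
rewrite h0 hN => e0 eN; have [ch _] := mch.
exists vs, k, N; split=> //; split; first by rewrite Nd.
move=> i i_n; split; first by lia.
set e := ((c + i) * p)%N; have eL : (e < (n + c.+1) * p)%N.
  by rewrite ltn_pmul2r //; lia.
exists (vtx (cls r) (vs (k e))); first by apply: map_f; rewrite mem_enum.
have ee : e = (i * p + c * p)%N by rewrite /e mulnDl addnC.
rewrite (minimal_point mch eL) act_vtx (@part_window _ _ u a0 u_gt0 _ _ i (c * p)).
- congr (vtx (_ * cls _) _); congr map; apply: eq_filter => j.
  rewrite ee eqn_add2l; congr andb; apply: asbool_equiv_eq.
  by apply: below_shift => j'; apply: lab_shift.
- by rewrite -ee ltnW.
- move=> j ji; rewrite ee; apply/andP; split; first by lia.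
  by apply/asboolP/(below_far E_irr _ u_gt0 u_connected); rewrite -mulnDl; nia.
move=> j /andP[ej jL]; rewrite negb_and -implybE; apply/implyP => nje.
by apply/asboolPn => /below_le; lia.
Qed.

End Connected.

Lemma vtx_expg h s v n : star_word E v s -> vtx (h * cls s ^+ n) v = vtx h v.
Proof.
move=> sv; elim: n => [|n IH]; first by rewrite expg0 mulg1.
by rewrite expgSr mulgA vtx_star.
Qed.

(* Each factor of the join lies in the star of a vertex of the other. *)
Lemma join_growth (u : word V) (P : pred V) (a b : V) : P a -> ~~ P b ->
  a \in map fst u -> b \in map fst u ->
  (forall x y, x \in map fst u -> y \in map fst u -> P x -> ~~ P y -> E x y) ->
  linear_growth (orbit_dist b (cls u)) 0 1.
Proof.
move=> Pa nPb au bu PE.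
have split_u (Q : pred V) : (forall x y, x \in map fst u -> y \in map fst u ->
    ~~ Q x -> Q y -> E x y) -> cls u =
    cls [seq x <- u | Q x.1] * cls [seq x <- u | ~~ Q x.1].
  move=> QE; have := @cls_split _ E _ id u (fun x => Q x.1) predT.
  rewrite filter_predT !map_id; apply=> //.
  apply: sub_in_pairwise (allss u) (_ : pairwise (fun _ _ => true) u).
    move=> x y xu yu _; apply/implyP=> /= /andP[nQx Qy].
    by apply: QE; rewrite ?map_f.
  by elim: (u) => //= x w ->; rewrite andbT; apply/allP.
have eP : cls u = cls [seq x <- u | P x.1] * cls [seq x <- u | ~~ P x.1].
  by apply: split_u => x y xu yu nPx Py; rewrite E_sym; apply: PE.
have eN : cls u = cls [seq x <- u | ~~ P x.1] * cls [seq x <- u | P x.1].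
  rewrite (split_u (predC P)) => [|x y xu yu /negPn Px nPy]; last exact: PE.
  by congr (_ * cls _); apply: eq_filter => x /=; rewrite negbK.
set uP := [seq x <- u | P x.1] in eP eN.
set uN := [seq x <- u | ~~ P x.1] in eP eN.
have sP : star_word E b uP.
  apply/allP=> z; rewrite mem_filter => /andP[Pz /(map_f fst) zu].
  by rewrite /star E_sym (PE z.1 b) ?orbT.
have sN : star_word E a uN.
  apply/allP=> z; rewrite mem_filter => /andP[Pz /(map_f fst) zu].
  by rewrite /star (PE a z.1) ?orbT.
have cPN : commute (cls uP) (cls uN) by rewrite /commute -eP.
exists 2 => n; split; last by [].
rewrite mul1n mul0n add0n /orbit_dist eP expgMn //.
apply: gdist_le => //.
have Eab : E a b by apply: PE.
(* Powers of [uP] fix the vertex [b] and powers of [uN] fix [a], so the translate of [a] by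
   [cls uP ^+ n] is adjacent to both ends. *)
rewrite -(vtx_expg 1 n sP) mul1g -[2%N]/(1 + 1)%N.
apply: (walkn_trans (y := vtx (cls uP ^+ n) a)).
  by apply/walkn1/ext_edge_vtx => //; rewrite E_sym.
rewrite -(vtx_expg (cls uP ^+ n) n sN).
by apply/walkn1/ext_edge_vtx.
Qed.

End Growth.

(** * Arbitrary elements *)

Section Conjugation.
Variables (V : finType) (E : rel V).
Hypotheses (E_sym : symmetric E) (E_irr : irreflexive E).
Hypothesis E_conn : forall u v : V, connect E u v.
Local Open Scope group_scope.
Local Notation cls := (cls E).

Lemma not_reduced (W : word V) : ~~ reduced E W ->
  exists W1 a W2 W3,
    W = W1 ++ a :: W2 ++ letter_inv a :: W3 /\ all (comm E a) W2.
Proof.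
elim: W => //= a W IH; rewrite negb_and negbK => /orP[].
  by move=> /can_cancel_catP[W2 [W3 [-> _ c2]]]; exists [::], a, W2, W3.
by move=> /IH[W1 [b [W2 [W3 [-> c2]]]]]; exists (a :: W1), b, W2, W3.
Qed.

(** A cancelling pair lies within one period, hence in a cyclic permutation of [u]; cancelling it
    there would give a shorter conjugate. *)
Lemma power_reduced_of_minimal (u : word V) (a0 : V * bool) (f : raag E) :
  (0 < size u)%N -> (exists h, cls u = f ^ h) ->
  (forall w h, cls w = f ^ h -> (size u <= size w)%N) ->
  forall n, reduced E [seq lam u a0 j | j <- iota 0 (n * size u)].
Proof.
move=> u0 [h uh] umin n;
  apply: contraT => /not_reduced[W1 [a [W2 [W3 [eW c2]]]]].
set p := size u in u0 eW *; set lam := lam u a0 in eW *.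
have szW := congr1 size eW;
  rewrite size_map size_iota !size_cat /= size_cat /= in szW.
have nthW j : (j < n * p)%N -> nth a0 (W1 ++ a :: W2 ++ letter_inv a :: W3) j = lam j.
  by move=> jn; rewrite -eW (nth_map 0%N) ?size_iota // nth_iota.
have lamp j : lam (p + j)%N = lam j by rewrite -[p]mul1n; apply: lam_shift.
set i := size W1 in szW.
have ai : lam i = a by rewrite -nthW ?nth_cat ?ltnn ?subnn //; lia.
have a'i : lam (i + (size W2).+1)%N = letter_inv a.
  rewrite -nthW; last by lia.
  by rewrite nth_cat ifF ?addKn /= ?nth_cat ?ltnn ?subnn //; lia.
(* At distance exactly [p] the two letters would be equal; at a larger one [W2] contains the next
   copy of [a], which is not adjacent to itself. *)
have W2p : (size W2 < p - 1)%N.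
  rewrite ltnNge; apply/negP => pW.
  have [W2p|W2p] : p = (size W2).+1 \/ (p - 1 < size W2)%N by lia.
    move: a'i; rewrite -W2p addnC lamp ai => /(congr1 snd) /=.
    by case: (a.2).
  have : nth a0 W2 (p - 1)%N = a.
    rewrite -ai -lamp -nthW; last by lia.
    rewrite nth_cat ifF; last by lia.
    have -> : (p + i - size W1)%N = (p - 1).+1 by lia.
    by rewrite /= nth_cat W2p.
  have /allP/(_ (nth a0 W2 (p - 1)%N)) := c2.
  by rewrite mem_nth // => /(_ isT) + e; rewrite e /comm E_irr.
pose w := [seq lam j | j <- iota i p].
have conj_w : cls w = cls u ^ cls [seq lam j | j <- iota 0 i].
  rewrite conjgE -[LHS](mulKg (cls [seq lam j | j <- iota 0 i])); congr (_ * _).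
  rewrite -cls_cat -map_cat -[X in iota X p]add0n -iotaD addnC iotaD map_cat cls_cat.
  congr (_ * _).
    have := cls_period E u a0 1; rewrite expg1 => <-.
    by rewrite mul1n.
  by rewrite add0n -[X in iota X]addn0 iotaDl -map_comp; congr cls;
    apply: eq_map.
pose r := [seq lam j | j <- iota (i.+1 + size W2).+1 (p - 2 - size W2)].
have ew : w = a :: W2 ++ letter_inv a :: r.
  have ip : iota i p = i :: iota i.+1 (size W2) ++
      (i.+1 + size W2)%N :: iota (i.+1 + size W2).+1 (p - 2 - size W2).
    have {1}-> : p = (1 + (size W2 + (1 + (p - 2 - size W2))))%N by lia.
    by rewrite !iotaD /= !addn1.
  rewrite /w ip /= map_cat /= ai addSnnS a'i -[(i + (size W2).+1)%N]addSnnS.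
  congr (_ :: _ ++ _).
  apply: (@eq_from_nth _ a0); first by rewrite size_map size_iota.
  move=> t; rewrite size_map size_iota => tW2.
  rewrite (nth_map 0%N) ?size_iota // nth_iota // -nthW; last by lia.
  rewrite nth_cat ifF; last by lia.
  have -> : (i.+1 + t - size W1)%N = t.+1 by rewrite -/i; lia.
  by rewrite /= nth_cat tW2.
have szw : size w = p by rewrite size_map size_iota.
have cc : can_cancel E a (W2 ++ letter_inv a :: r)
  by rewrite can_cancel_comm //= eqxx.
have := umin (mull E a (W2 ++ letter_inv a :: r)) (h * cls [seq lam j | j <- iota 0 i]).
rewrite cls_mull -ew conj_w uh -conjgM => /(_ erefl).
rewrite /mull cc; move/can_cancel_catP: cc => [X1 [X2 [eX -> _]]].
by move: szw; rewrite ew eX /= !size_cat /= -/p; lia.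
Qed.

Lemma minimal_conjugate (f : raag E) : exists u h, cls u = f ^ h /\
  forall w h', cls w = f ^ h' -> (size u <= size w)%N.
Proof.
pose P n := `[< exists u h, cls u = f ^ h /\ size u = n >].
have exP : exists n, P n.
  have [u uf] := cls_surj f; exists (size u); apply/asboolP; exists u, 1.
  by rewrite conjg1.
case: (ex_minnP exP) => n /asboolP[u [h [uh <-]]] umin; exists u, h; split=> //.
by move=> w h' wh; apply: umin; apply/asboolP; exists w, h'.
Qed.

(** * Short cycles and the growth of arbitrary elements *)

Definition no_short_cycle :=
  forall c : seq V, embedded_cycle E c -> (6 <= size c)%N.

Lemma no_short_triangle a b c : no_short_cycle -> E a b -> E b c ->
  E c a -> False.
Proof.
move=> girth6 ab bc ca.
have neq x y : E x y -> x != y by apply: contraTneq => ->; rewrite E_irr.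
have := girth6 [:: a; b; c]; rewrite /embedded_cycle /= !inE ab bc ca.
by rewrite negb_or (neq a b) // (neq b c) // eq_sym (neq c a) // => /(_ isT).
Qed.

Lemma no_short_square a b c d : no_short_cycle ->
  E a b -> E b c -> E c d -> E d a -> (a = c) \/ (b = d).
Proof.
move=> girth6 ab bc cd da.
have neq x y : E x y -> x != y by apply: contraTneq => ->; rewrite E_irr.
have [->|ac] := eqVneq a c; first by left.
have [->|bd] := eqVneq b d; first by right.
have := girth6 [:: a; b; c; d]; rewrite /embedded_cycle /= !inE ab bc cd da.
have ad : a != d by rewrite eq_sym neq.
by rewrite !negb_or ac bd ad (neq a b) // (neq b c) // (neq c d) // => /(_ isT).
Qed.

Lemma no_short_pentagon a b c d e : no_short_cycle ->
  E a b -> E b c -> E c d -> E d e -> E e a -> False.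
Proof.
move=> girth6 ab bc cd de ea.
have neq x y : E x y -> x != y by apply: contraTneq => ->; rewrite E_irr.
have neq2 x y z : E x y -> E y z -> E z x = false.
  by move=> xy yz; apply/negP; apply: no_short_triangle xy yz.
have ac : a != c by apply: contraTneq cd => <-; rewrite (neq2 d e a).
have ad : a != d by apply: contraTneq cd => <-; rewrite (neq2 a b c).
have bd : b != d by apply: contraTneq de => <-; rewrite (neq2 e a b).
have be : b != e by apply: contraTneq de => <-; rewrite (neq2 b c d).
have ce : c != e by apply: contraTneq ea => <-; rewrite (neq2 a b c).
have := girth6 [:: a; b; c; d; e];
  rewrite /embedded_cycle /= !inE ab bc cd de ea.
have ae : a != e by rewrite eq_sym neq.
rewrite !negb_or ac ad ae bd be ce (neq a b) // (neq b c) // (neq c d) //.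
by rewrite (neq d e) // => /(_ isT).
Qed.

(** The support of a shortest conjugate is empty, connected in the complement graph, or a join; in
    the first and last cases the orbit is bounded. *)
Lemma minimal_growth (u : word V) (f : raag E) (v : V) :
  (exists h, cls u = f ^ h) ->
  (forall w h, cls w = f ^ h -> (size u <= size w)%N) ->
  exists v0 m q, [/\ (0 < q)%N, no_short_cycle -> (q <= #|V|)%N
    & linear_growth (orbit_dist v0 (cls u)) m q].
Proof.
move=> uh umin; case: u uh umin => [|a0 u] uh umin.
  exists v, 0%N, 1%N; split=> // [_|]; first by apply/card_gt0P; exists v.
  exists 0 =>
    n; split=> //; rewrite mul1n mul0n addn0 /orbit_dist cls_nil expg1n.
  by apply: gdist_le; apply: walkn0.
have red := @power_reduced_of_minimal (a0 :: u) a0 f isT uh umin.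
pose e := fun x y => ~~ E x y && (y \in map fst (a0 :: u)).
have [/forallP conn|] := boolP [forall a, forall b,
    (a \in map fst (a0 :: u)) && (b \in map fst (a0 :: u)) ==> connect e a b].
  have {}conn a b : a \in map fst (a0 :: u) -> b \in map fst (a0 :: u) -> connect e a b.
    by move=> au bu; have /forallP/(_ b) := conn a; rewrite au bu.
  have [g6|ng6] := pselect no_short_cycle.
    have [|||m [q [/andP[q0 qV] gr]]] := large_girth_growth E_sym E_irr E_conn
      (u := a0 :: u) isT red conn.
    - by move=> *; apply: no_short_triangle g6 _ _ _; eassumption.
    - by move=> *; apply: no_short_square g6 _ _ _ _.
    - by move=> *; apply: no_short_pentagon g6 _ _ _ _ _; eassumption.
    by exists a0.1, m, q.
  have [m [q [q0 gr]]] := connected_growth E_sym E_irr E_conn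
    (u := a0 :: u) isT red conn.
  by exists a0.1, m, q.
rewrite negb_forall => /existsP[a]; rewrite negb_forall => /existsP[b].
rewrite negb_imply => /andP[/andP[au bu] nab].
exists b, 0%N, 1%N; split=> // [_|]; first by apply/card_gt0P; exists v.
(* The component of [a] in the complement graph is one factor of the join. *)
apply: (join_growth E_sym E_irr (P := connect e a) (a := a)) => //.
move=> x y xu yu ax; apply: contraNT => nxy; apply: connect_trans ax _.
by apply: connect1; rewrite /e nxy.
Qed.

Lemma translation_growth (g : raag E) (v : V) : exists m q,
  [/\ (0 < q)%N, no_short_cycle -> (q <= #|V|)%N
    & forall x : ext_vertex E, linear_growth
        (fun n => gdist (@ext_edge _ E) x (ext_act x (g ^+ n))) m q].
Proof.
(* The right action of [g] multiplies labels by [g^-1] on the left. *)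
have [u [h [uh umin]]] := minimal_conjugate g^-1.
have [v0 [m [q [q0 qV [K hK]]]]] := minimal_growth v (ex_intro _ h uh) umin.
exists m, q; split=> // x; pose y := vtx (h : raag E) v0.
pose d := gdist (@ext_edge _ E).
have dy n : d y (ext_act y (g ^+ n)) = orbit_dist v0 (cls u) n.
  rewrite /d /y ext_act_vtx /orbit_dist -[RHS](gdist_vtx E_sym E_irr E_conn h) mulg1.
  congr (gdist _ _ (vtx _ _)).
  by rewrite uh -conjXg conjgE expVgn !mulgA mulgV mul1g.
exists (K + q * (d x y + d y x))%N => n; have := hK n; rewrite -dy => -[h1 h2].
pose x' := ext_act x (g ^+ n); pose y' := ext_act y (g ^+ n).
have t1 := gdist_triangle E_sym E_irr E_conn x y x'.
have t2 := gdist_triangle E_sym E_irr E_conn y y' x'.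
have t3 := gdist_triangle E_sym E_irr E_conn y x y'.
have t4 := gdist_triangle E_sym E_irr E_conn x x' y'.
rewrite /x' /y' !gdist_act // -/d in t1 t2 t3 t4.
rewrite -/d -/x' -/y' in h1 h2 t1 t2 t3 t4 *.
by split; nia.
Qed.

End Conjugation.

Import Order.TTheory GRing.Theory Num.Theory.

(** * From linear growth to the limit *)

Section Limit.
Local Open Scope ring_scope.
Local Open Scope classical_set_scope.

Lemma linear_growth_lim (R : realType) (D : nat -> nat) (m q : nat) :
  (0 < q)%N -> linear_growth D m q ->
  limn (fun n : nat => (D n)%:R / n%:R : R) = m%:R / q%:R.
Proof.
move=> q0 [K hK]; apply: cvg_lim => //.
apply/cvgrPdist_le => e e0; near=> n.
(* Dividing the growth bounds by [q * n] leaves an error of at most [K / n]. *)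
have nK : K%:R / e < n%:R :> R by near: n; exact: nbhs_infty_gtr.
have q1 : 1 <= q%:R :> R by rewrite ler1n.
have n0 : 0 < n%:R :> R by apply: le_lt_trans nK; rewrite divr_ge0 // ltW.
have nKe : K%:R < n%:R * e by rewrite -ltr_pdivrMr.
have [h1 h2] := hK n.
have {}h1 : q%:R * (D n)%:R <= m%:R * n%:R + K%:R :> R.
  by rewrite -!natrM -natrD ler_nat.
have {}h2 : m%:R * n%:R <= q%:R * (D n)%:R + K%:R :> R.
  by rewrite -!natrM -natrD ler_nat.
have qn0 : 0 < q%:R * n%:R :> R by rewrite mulr_gt0 //; lra.
have -> : m%:R / q%:R - (D n)%:R / n%:R =
    (m%:R * n%:R - q%:R * (D n)%:R) / (q%:R * n%:R) :> R.
  by field; rewrite !lt0r_neq0 //; lra.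
rewrite normrM normfV [`|q%:R * _|]gtr0_norm // ler_pdivrMr // ler_norml.
have : n%:R * e <= e * (q%:R * n%:R) by nra.
by move=> ?; apply/andP; split; lra.
Unshelve. all: by end_near.
Qed.

End Limit.

Local Open Scope ring_scope.

Theorem theorem1 (R : realType) (V : finType) (E : rel V)
    (E_sym : symmetric E) (E_irrefl : irreflexive E)
    (E_connected : forall u v : V, connect E u v) :
  (forall g : raag E, loxodromic R g ->
     forall x : ext_vertex E,
       exists q : rat, translation_length R x g = ratr q) /\
  ((6%R%:E <= girth R E)%E ->
     exists D : nat, (0 < D)%N /\
       forall g : raag E, loxodromic R g ->
       forall x : ext_vertex E,
         D%:R * translation_length R x g \is a Num.int).
Proof.
split=> [g _ x|girth6].
  have [_ [v _]] := ext_vertexP x.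
  have [m [q [q0 _ gr]]] := translation_growth E_sym E_irrefl E_connected g v.
  exists (m%:R / q%:R); rewrite /translation_length (linear_growth_lim R q0 (gr x)).
  by rewrite [RHS]fmorph_div /= !ratr_nat.
have cyc : no_short_cycle E.
  move=> c cE; have : (girth R E <= (size c)%:R%:E)%E.
    by apply: ereal_inf_lbound; exists c.
  by move=> /(le_trans girth6); rewrite lee_fin ler_nat.
(* Every denominator [q] is positive and at most [#|V|], hence divides the factorial. *)
exists (#|V|)`!; split=> [|g _ x]; first exact: fact_gt0.
have [_ [v _]] := ext_vertexP x.
have [m [q [q0 qV gr]]] := translation_growth E_sym E_irrefl E_connected g v.
rewrite /translation_length (linear_growth_lim R q0 (gr x)).
have /dvdnP[t ->] : (q %| (#|V|)`!)%N by rewrite dvdn_fact // q0 qV.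
have qn0 : q%:R != 0 :> R by rewrite pnatr_eq0 -lt0n.
have -> : (t * q)%:R * (m%:R / q%:R) = (t * m)%:R :> R.
  by rewrite !natrM; field.
exact: natr_int.
Qed.
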